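(* Let $(\omega_n)_{n\ge0}$ be a sequence of nonzero (complex) scalars, and put $\mu_{i,j}=\omega_{i+j}$ for $i,j\ge0$. Consider $$X=\ell^2(V_\infty,\mu),\qquad \|f\|_X^2=\sum_{i,j\ge0}|\omega_{i+j}f(v_{i,j})|^2,$$ and suppose that the backward shift $B$ of the lattice graph $G_\infty$ is bounded on $X$. Then the following assertions hold. (i) $B$ is hypercyclic, equivalently weakly mixing, if and only if $$\liminf_{n\to\infty}\frac{|\omega_{q+n}|}{|\omega_q|}\,\frac{(n+1)^{q/2+1/4}}{2^n}=0\qquad\text{for every }q\in\mathbb N_0.$$ (That is, hypercyclicity of $B$, weak mixing of $B$, and the displayed condition are all equivalent.) (ii) $B$ is mixing if and only if $$\lim_{n\to\infty}\frac{|\omega_{q+n}|}{|\omega_q|}\,\frac{(n+1)^{q/2+1/4}}{2^n}=0\qquad\text{for every }q\in\mathbb N_0.$$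
   Context: $\mathbb N_0=\{0,1,2,\dots\}$. $G_\infty$ is the directed graph with vertex set $V_\infty=\{v_{i,j}:i,j\in\mathbb N_0\}$ and edges $v_{i,j}\to v_{i+1,j}$ and $v_{i,j}\to v_{i,j+1}$ for all $i,j\in\mathbb N_0$. $\ell^2(V_\infty,\mu)$ is the Hilbert space of functions $f:V_\infty\to\mathbb C$ with $\|f\|_X<\infty$. The backward shift sums over children: $(Bf)(v_{i,j})=f(v_{i+1,j})+f(v_{i,j+1})$. A bounded linear operator $T$ on a separable infinite-dimensional Banach space $X$ is hypercyclic if there is $x\in X$ whose orbit $\{T^nx:n\in\mathbb N_0\}$ is dense in $X$; weakly mixing if $T\oplus T$, $(x,y)\mapsto(Tx,Ty)$, is hypercyclic on $X\oplus X$; mixing if for every pair of nonempty open sets $U,V\subseteq X$ there is $n_0\in\mathbb N_0$ such that $T^n(U)\cap V\ne\varnothing$ for all $n\ge n_0$. *)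

(* Defs.v *)
From HB Require Import structures.
From mathcomp Require Import all_boot all_order all_algebra.
From mathcomp Require Import complex.
From mathcomp Require Import all_classical all_reals all_analysis.
From mathcomp Require Import ring lra.
Set Implicit Arguments.
Unset Strict Implicit.
Unset Printing Implicit Defensive.
Import Order.TTheory GRing.Theory Num.Theory.
Import numFieldNormedType.Exports.
Import Normc.

Local Open Scope classical_set_scope.
Local Open Scope complex_scope.
Local Open Scope ring_scope.

Section linear_dynamics.
Context {K : numFieldType}.
Implicit Types X : normedModType K.

Definition bounded_operator X (T : X -> X) : Prop :=
  exists M : K, forall x, `|T x| <= M * `|x|.

Definition hypercyclic X (T : X -> X) : Prop :=
  exists x : X, dense [set iter n T x | n in [set: nat]].

Definition weakly_mixing X (T : X -> X) : Prop :=
  hypercyclic (fun p : (X * X)%type => (T p.1, T p.2)).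

Definition mixing X (T : X -> X) : Prop :=
  forall U W : set X, open U -> U !=set0 -> open W -> W !=set0 ->
  exists n0 : nat, forall n, (n0 <= n)%N -> (iter n T @` U) `&` W !=set0.

End linear_dynamics.

(* The value [normc z : R] is the modulus of [z] as a real number; the generic
   norm [`|z|] on [R[i]] is the same number seen in [R[i]], and so is the norm
   of a [normedModType R[i]]. *)
Section weighted_l2.
Context {R : realType} {V : choiceType}.
Implicit Types (mu f g : V -> R[i]).
Local Open Scope ereal_scope.

Definition l2_sqnorm mu f : \bar R :=
  \esum_(v in [set: V]) ((normc (mu v * f v)%R) ^+ 2)%:E.

Definition l2_pred mu : {pred V -> R[i]} := fun f => l2_sqnorm mu f < +oo.

(* The weight has no zero, so that the norm is definite; the proof of this is
   carried by the type for the sake of the normed module structure below. *)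
Record l2 mu (mu_neq0 : forall v, mu v != 0%R) := L2 {
  l2_fun :> V -> R[i] ;
  l2_funP : l2_fun \in l2_pred mu }.

End weighted_l2.

Section weighted_l2_normedModType.
Context {R : realType} {V : choiceType} (mu : V -> R[i]).
Implicit Types (f g : V -> R[i]).

Lemma l2_sqnorm_ge0 f : (0 <= l2_sqnorm mu f)%E.
Proof. by apply: esum_ge0 => v _; rewrite lee_fin sqr_ge0. Qed.

Lemma l2_sqnorm_fin f : f \in l2_pred mu -> l2_sqnorm mu f \is a fin_num.
Proof. by move=> ?; rewrite ge0_fin_numE// l2_sqnorm_ge0. Qed.

Lemma le_esumZ (a : V -> \bar R) (c : R) : (0 <= c)%R ->
  (forall v, 0 <= a v)%E ->
  (\esum_(v in [set: V]) (c%:E * a v) <= c%:E * \esum_(v in [set: V]) a v)%E.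
Proof.
move=> c0 a0; apply: ge_ereal_sup => _ [A [finA _] <-].
rewrite -ge0_mule_fsumr//; apply: lee_pmul => //.
- by apply: fsume_ge0.
- by apply: ereal_sup_ubound; exists A.
Qed.

Lemma normc_ge0 (z : R[i]) : 0 <= normc z.
Proof. by case: z => a b; exact: sqrtr_ge0. Qed.

Lemma l2_sqnormZ_le (c : R[i]) f :
  (l2_sqnorm mu (c *: f)%R <= (normc c ^+ 2)%:E * l2_sqnorm mu f)%E.
Proof.
rewrite -[X in (_ <= X)%E]/((normc c ^+ 2)%:E * esum _ _)%E.
apply: le_trans (le_esumZ _ _); last 2 first.
- exact: sqr_ge0.
- by move=> v; rewrite lee_fin sqr_ge0.
apply: le_esum => v _; rewrite -EFinM lee_fin -exprMn -normcM.
by rewrite mulrCA.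
Qed.

Lemma l2_sqnormD_le (t : R) f g : 0 < t ->
  (l2_sqnorm mu (f + g)%R <=
   (1 + t)%:E * l2_sqnorm mu f + (1 + t^-1)%:E * l2_sqnorm mu g)%E.
Proof.
move=> t0; have ti0 : 0 < t^-1 by rewrite invr_gt0.
have sq0 h v : (0 <= ((normc (mu v * h v)) ^+ 2)%:E :> \bar R)%E.
  by rewrite lee_fin sqr_ge0.
apply: le_trans (leeD (le_esumZ _ (sq0 f)) (le_esumZ _ (sq0 g))); last 2 first.
- by lra.
- by lra.
rewrite -esumD; last 2 first.
- by move=> v _; rewrite -EFinM lee_fin mulr_ge0 ?sqr_ge0//; lra.
- by move=> v _; rewrite -EFinM lee_fin mulr_ge0 ?sqr_ge0//; lra.
apply: le_esum => v _; rewrite -!EFinM -EFinD lee_fin.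
rewrite -[(f + g) v]/(f v + g v) mulrDr.
set x := mu v * f v; set y := mu v * g v.
apply: (@le_trans _ _ ((normc x + normc y) ^+ 2)).
  by rewrite lerXn2r ?nnegrE ?addr_ge0 ?normc_ge0//; exact: le_normcD.
rewrite -subr_ge0 [X in 0 <= X](_ : _ = t^-1 * (t * normc x - normc y) ^+ 2).
  by rewrite mulr_ge0 ?sqr_ge0// ltW.
by field; rewrite gt_eqF.
Qed.

Lemma l2_pred_submod : submod_closed (l2_pred mu).
Proof.
split=> [|c f g fP gP].
  rewrite /in_mem/= /l2_pred /l2_sqnorm esum1 ?ltry// => v _.
  by rewrite mulr0 normc0 expr0n.
rewrite /in_mem/= /l2_pred.
apply: (le_lt_trans (l2_sqnormD_le _ _ ltr01)).
apply: (@le_lt_trans _ _ ((1 + 1)%:E * ((normc c ^+ 2)%:E * l2_sqnorm mu f) +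
  (1 + 1^-1)%:E * l2_sqnorm mu g)%E).
  rewrite leeD2r// lee_wpmul2l ?l2_sqnormZ_le//.
by rewrite -(fineK (l2_sqnorm_fin fP)) -(fineK (l2_sqnorm_fin gP)) -!EFinM ltry.
Qed.

HB.instance Definition _ :=
  GRing.isSubmodClosed.Build _ _ (l2_pred mu) l2_pred_submod.

Variable mu_neq0 : forall v, mu v != 0.
Local Notation X := (l2 mu_neq0).

HB.instance Definition _ := [isSub for (@l2_fun R V mu mu_neq0)].
HB.instance Definition _ := [Choice of X by <:].
HB.instance Definition _ := [SubChoice_isSubLmodule of X by <:].

Definition l2_norm (f : X) : R[i] := (Num.sqrt (fine (l2_sqnorm mu f)))%:C.

Lemma l2_norm0_eq0 (f : X) : l2_norm f = 0 -> f = 0.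
Proof.
move=> /(congr1 (@complex.Re R))/= /eqP; rewrite sqrtr_eq0 => f0.
apply/val_inj/funext => v /=.
have : ((normc (mu v * f v) ^+ 2)%:E <= l2_sqnorm mu f)%E.
  apply: esum_ge; exists [set v]; last by rewrite fsbig_set1.
  by split; [exact: finite_set1|].
rewrite -(fineK (l2_sqnorm_fin (l2_funP f))) lee_fin => le0.
have /eqP : normc (mu v * f v) ^+ 2 == 0.
  by rewrite eq_le sqr_ge0 andbT (le_trans le0).
move=> /eqP; rewrite sqrf_eq0 => /eqP/eq0_normc/eqP.
by rewrite mulf_eq0 (negbTE (mu_neq0 v)) => /eqP.
Qed.

Lemma l2_normZ (c : R[i]) (f : X) : l2_norm (c *: f) = `|c| * l2_norm f.
Proof.
have -> : `|c| = (normc c)%:C by case: c.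
rewrite /l2_norm -rmorphM; congr _%:C.
have le_norm (d : R[i]) (g : X) : Num.sqrt (fine (l2_sqnorm mu (d *: g : X))) <=
    normc d * Num.sqrt (fine (l2_sqnorm mu g)).
  rewrite -[normc d]ger0_norm ?normc_ge0// -sqrtr_sqr -sqrtrM ?sqr_ge0//.
  rewrite ler_wsqrtr// -lee_fin EFinM.
  by rewrite !fineK ?l2_sqnorm_fin ?l2_funP// l2_sqnormZ_le.
have [->|c0] := eqVneq c 0.
  apply/eqP; rewrite eq_le (le_trans (le_norm _ _)).
    by rewrite normc0 mul0r sqrtr_ge0.
  by rewrite normc0 mul0r.
apply/eqP; rewrite eq_le le_norm/=.
have nc0 : 0 < normc c.
  by rewrite lt_neqAle normc_ge0 andbT eq_sym; apply: contra c0 => /eqP/eq0_normc->.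
have := le_norm c^-1 (c *: f); rewrite scalerA mulVf// scale1r normcV.
by rewrite ler_pdivlMl.
Qed.

Lemma ler_l2_normD (f g : X) : l2_norm (f + g) <= l2_norm f + l2_norm g.
Proof.
have [/eqP/l2_norm0_eq0 ->|f0] := boolP (l2_norm f == 0).
  rewrite add0r lerDr; rewrite /l2_norm ler0c; exact: sqrtr_ge0.
have [/eqP/l2_norm0_eq0 ->|g0] := boolP (l2_norm g == 0).
  rewrite addr0 lerDl; rewrite /l2_norm ler0c; exact: sqrtr_ge0.
move: f0 g0; rewrite /l2_norm -rmorphD lecR !(inj_eq (@complexI R)).
set P := Num.sqrt (fine (l2_sqnorm mu f)).
set Q := Num.sqrt (fine (l2_sqnorm mu g)) => P0 Q0.
have Pgt0 : 0 < P by rewrite lt_neqAle eq_sym P0 sqrtr_ge0.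
have Qgt0 : 0 < Q by rewrite lt_neqAle eq_sym Q0 sqrtr_ge0.
have sqP (h : X) :
    l2_sqnorm mu h = ((Num.sqrt (fine (l2_sqnorm mu h))) ^+ 2)%:E.
  by rewrite sqr_sqrtr ?fine_ge0 ?l2_sqnorm_ge0// fineK ?l2_sqnorm_fin ?l2_funP.
rewrite -[P + Q]ger0_norm ?addr_ge0 ?sqrtr_ge0// -sqrtr_sqr ler_wsqrtr//.
rewrite -lee_fin fineK ?l2_sqnorm_fin ?l2_funP//.
have t0 : 0 < Q / P by rewrite divr_gt0.
apply: (le_trans (l2_sqnormD_le f g t0)).
rewrite (sqP f) (sqP g) -/P -/Q -!EFinM -EFinD lee_fin.
rewrite le_eqVlt; apply/orP; left; apply/eqP.
by field; rewrite P0 Q0.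
Qed.

HB.instance Definition _ := @Lmodule_isNormed.Build R[i] X
  l2_norm ler_l2_normD l2_normZ l2_norm0_eq0.

Lemma l2_normE (f : X) : `|f| = (Num.sqrt (fine (l2_sqnorm mu f)))%:C.
Proof. by []. Qed.

End weighted_l2_normedModType.

Section lattice_graph.

Definition lattice_children (v : nat * nat) : seq (nat * nat) :=
  [:: (v.1.+1, v.2); (v.1, v.2.+1)].

Definition backward_shift (C : nmodType) (f : nat * nat -> C) (v : nat * nat) :
  C := \sum_(w <- lattice_children v) f w.

Lemma backward_shiftE (C : nmodType) (f : nat * nat -> C) i j :
  backward_shift f (i, j) = f (i.+1, j) + f (i, j.+1).
Proof. by rewrite /backward_shift !big_cons big_nil addr0. Qed.

Definition lattice_weight (C : Type) (omega : nat -> C) (v : nat * nat) : C :=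
  omega (v.1 + v.2)%N.

Lemma lattice_weight_neq0 (C : nmodType) (omega : nat -> C) :
  (forall n, omega n != 0) -> forall v, lattice_weight omega v != 0.
Proof. by move=> omega_neq0 v; exact: omega_neq0. Qed.

End lattice_graph.

(* Main.v *)
Require Import Defs.
From HB Require Import structures.
From mathcomp Require Import all_boot all_order all_algebra.
From mathcomp Require Import complex.
From mathcomp Require Import all_classical all_reals all_analysis.
From mathcomp Require Import ring lra zify.
Import Order.TTheory GRing.Theory Num.Theory.
Import numFieldNormedType.Exports.
Import Normc.
Set Implicit Arguments.
Unset Strict Implicit.
Unset Printing Implicit Defensive.
Local Open Scope classical_set_scope.
Local Open Scope complex_scope.
Local Open Scope ring_scope.

(* Write a function on the lattice as the sequence of its restrictions to the
   levels [i + j = N], each indexed by [i].  Between levels the shift is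
   [(L h) i = h i + h i.+1], whose adjoint is multiplication by [1 + X] on
   coefficient sequences of polynomials.

   Necessity: the functional on level [q] given by the coefficients of
   [(1 - X) ^ q] pulls back under [L ^ n] to those of [(1 - X) ^ q (1 + X) ^ n],
   whose squared norm is of order [4 ^ n n ^ (- q - 1/2)] by the parallelogram
   identity.  The values of this functional along the orbit of a hypercyclic
   vector are frequently at least 1, whereas the level norms of the vector tend
   to 0.

   Sufficiency: every vector of level [q] has preimages under [L ^ n] of squared
   norm O(n ^ (q + 1/2) / 4 ^ n).  By induction on [q] (apply [L] once), only the
   kernel of [L] has to be treated, that is, the alternating vector; a multiple of
   it is the image of [(1 + X) ^ n r] with
   [r = \sum_l (-1) ^ l 'C(n + l, n) 'C(n + q - l, n) X ^ l].
   Summing preimages of a dense sequence along a sparse sequence of times gives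
   an orbit dense in the product of two copies of the space. *)

(** * Binomial sums *)

(** Pascal's rule for ['C(m.+1, j)] and a reindexing: up to sign, a finite difference of order
    [m.+1] is one of order [m] of the first difference. *)
Lemma alternating_sumS (A : comPzRingType) (u : nat -> A) m :
  \sum_(j < m.+2) (-1) ^+ j * 'C(m.+1, j)%:R * u j =
  \sum_(j < m.+1) (-1) ^+ j * 'C(m, j)%:R * (u j - u j.+1).
Proof.
transitivity (\sum_(j < m.+1) (-1) ^+ j * 'C(m, j)%:R * u j -
   \sum_(j < m.+1) (-1) ^+ j * 'C(m, j)%:R * u j.+1); last first.
  by rewrite -sumrB; apply: eq_bigr => j _; rewrite mulrBr.
rewrite big_ord_recl /= [X in _ = X - _]big_ord_recl /= !bin0 -addrA.
congr (_ + _).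
transitivity (\sum_(j < m.+1)
   ((-1) ^+ j.+1 * 'C(m, j.+1)%:R * u j.+1 - (-1) ^+ j * 'C(m, j)%:R * u j.+1)).
  apply: eq_bigr => j _; rewrite /bump /= add1n binS natrD exprS; ring.
rewrite sumrB big_ord_recr /= (bin_small (ltnSn m)) mulr0 mul0r addr0.
congr (_ - _).
Qed.

(** Up to sign this is the [m]-th finite difference of a polynomial in [j] of degree [a + b = m], so
    only the leading coefficient survives. By Pascal's rule the first difference splits into two
    products with one binomial index lowered; [m <= t] keeps [t - j] from truncating. *)
Lemma alternating_bin_sum (A : comPzRingType) m a b s t :
  (a + b)%N = m -> (m <= t)%N ->
  \sum_(j < m.+1) (-1) ^+ j * 'C(m, j)%:R * ('C(s + j, a) * 'C(t - j, b))%:R =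
  (-1) ^+ a * 'C(m, a)%:R :> A.
Proof.
elim: m a b s t => [|m IHm] a b s t.
  case: a => [|//]; case: b => [|//] _ _.
  by rewrite big_ord_recl big_ord0 !bin0 !mulr1 addr0.
move=> abm mt; have t0 : (0 < t)%N by case: t mt.
have mt1 : (m <= t.-1)%N by case: t mt t0.
rewrite (alternating_sumS (fun j => ('C(s + j, a) * 'C(t - j, b))%:R)).
have tE j : (j < m.+1)%N -> (t - j)%N = (t.-1 - j).+1 /\ (t - j.+1)%N = (t.-1 - j)%N.
  by move=> jm; case: t mt t0 mt1 => // t mt _ /= tm; rewrite subSn ?subSS// (leq_trans _ tm).
case: a abm => [|a] abm.
  rewrite add0n in abm; rewrite abm.
  rewrite (eq_bigr (fun j : 'I_m.+1 => (-1) ^+ j * 'C(m, j)%:R *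
     ('C(s + j, 0) * 'C(t.-1 - j, m))%:R)).
    by rewrite IHm// !bin0.
  move=> j _; have [-> ->] := tE j (ltn_ord j).
  by rewrite !bin0 !mul1n binS natrD; ring.
case: b abm => [|b] abm.
  rewrite addn0 in abm; rewrite abm.
  rewrite (eq_bigr (fun j : 'I_m.+1 => - ((-1) ^+ j * 'C(m, j)%:R *
     ('C(s + j, m) * 'C(t.-1 - j, 0))%:R))).
    by rewrite sumrN IHm ?addn0// !binn exprS; ring.
  move=> j _; rewrite !bin0 !muln1 addnS binS natrD; ring.
rewrite (eq_bigr (fun j : 'I_m.+1 => (-1) ^+ j * 'C(m, j)%:R *
     ('C(s + j, a.+1) * 'C(t.-1 - j, b))%:R -
   (-1) ^+ j * 'C(m, j)%:R *
     ('C(s + j, a) * 'C(t.-1 - j, b.+1))%:R)).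
  move: abm; rewrite addSn => -[abm].
  rewrite sumrB !IHm//; last by rewrite -abm addnS addSn.
  by rewrite binS natrD exprS; ring.
move=> j _; have [-> ->] := tE j (ltn_ord j).
by rewrite addnS !binS !natrM !natrD; ring.
Qed.

Section real_combinatorics.
Context {R : realType}.

Lemma coef_1DXn n k : (((1 + 'X) ^+ n : {poly R})`_k) = 'C(n, k)%:R.
Proof.
rewrite exprDn coef_sum.
rewrite (eq_bigr (fun i : 'I_n.+1 => (k == i)%:R * 'C(n, i)%:R)); last first.
  by move=> i _; rewrite expr1n mul1r coefMn coefXn -[LHS]mulr_natr.
have [kn|nk] := ltnP k n.+1.
  rewrite (bigD1 (Ordinal kn))//= eqxx mul1r big1 ?addr0//. move=> i.
  by rewrite -val_eqE /= eq_sym => /negbTE ->; rewrite mul0r.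
rewrite bin_small// big1// => i _; case: eqP => [ki|]; last by rewrite mul0r.
by move: (ltn_ord i); rewrite -ki ltnNge nk.
Qed.


Lemma central_bin_succ n :
  n.+1%:R * 'C((n.+1).*2, n.+1)%:R = (4 * n + 2)%:R * 'C(n.*2, n)%:R :> R.
Proof.
rewrite -!natrM; congr _%:R; apply/eqP.
have f0 : (0 < n.+1`! * n`!)%N by rewrite muln_gt0 !fact_gt0.
rewrite -(eqn_pmul2r f0).
have h1 : ('C(n.+1.*2, n.+1) * (n.+1`! * n.+1`!))%N = (n.+1.*2)`!.
  by rewrite -[in RHS](@bin_fact _ n.+1) -addnn ?leq_addr// addnK.
have h2 : ('C(n.*2, n) * (n`! * n`!))%N = (n.*2)`!.
  by rewrite -[in RHS](@bin_fact _ n) -addnn ?leq_addr// addnK.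
apply/eqP; transitivity ((n.+1.*2)`!).
  by rewrite -h1 !factS; ring.
by rewrite doubleS !factS -h2 -muln2; ring.
Qed.

(** By the recursion, the quotient of the left side by the right side decreases in [n]; the quotient
    in the lower bound below is monotone for the same reason. Together they give ['C(n.*2, n)] the
    exact order [4 ^ n / sqrt n]. *)
Lemma central_bin_ub n : 'C(n.*2, n)%:R ^+ 2 * n.+1%:R <= 16 ^+ n :> R.
Proof.
elim: n => [|n IHn]; first by rewrite bin0 expr0 expr1n mulr1.
have := central_bin_succ n; set c := 'C(n.*2, n)%:R in IHn *.
set d := 'C(n.+1.*2, n.+1)%:R => e.
have n0 : (0 : R) <= n%:R by rewrite ler0n.
have e2 : n.+1%:R ^+ 2 * d ^+ 2 = (4 * n + 2)%:R ^+ 2 * c ^+ 2 by rewrite -!exprMn e.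
rewrite -(ler_pM2l (_ : 0 < n.+1%:R ^+ 3)); last by rewrite exprn_gt0 ?ltr0n.
apply: (@le_trans _ _ ((4 * n + 2)%:R ^+ 2 * (n.+2%:R) * (c ^+ 2 * n.+1%:R))).
  rewrite [leLHS](_ : _ = (n.+1%:R ^+ 2 * d ^+ 2) * n.+1%:R * n.+2%:R); last by ring.
  by rewrite e2 le_eqVlt; apply/orP; left; apply/eqP; ring.
apply: (@le_trans _ _ ((4 * n + 2)%:R ^+ 2 * (n.+2%:R) * 16 ^+ n)).
  by rewrite ler_wpM2l// mulr_ge0 ?sqr_ge0.
rewrite [16 ^+ n.+1]exprS mulrA ler_wpM2r ?exprn_ge0//.
rewrite -!(natr1, natrD, natrM); nra.
Qed.

Lemma central_bin_lb n : 16 ^+ n <= 'C(n.*2, n)%:R ^+ 2 * (4 * n + 1)%:R :> R.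
Proof.
elim: n => [|n IHn]; first by rewrite bin0 expr0 expr1n mul1r.
have := central_bin_succ n; set c := 'C(n.*2, n)%:R in IHn *.
set d := 'C(n.+1.*2, n.+1)%:R => e.
have n0 : (0 : R) <= n%:R by rewrite ler0n.
have e2 : n.+1%:R ^+ 2 * d ^+ 2 = (4 * n + 2)%:R ^+ 2 * c ^+ 2 by rewrite -!exprMn e.
have c0 : 0 <= c ^+ 2 by rewrite sqr_ge0.
rewrite -(ler_pM2l (_ : 0 < n.+1%:R ^+ 2)); last by rewrite exprn_gt0 ?ltr0n.
rewrite mulrA e2 [16 ^+ n.+1]exprS.
apply: (@le_trans _ _ (n.+1%:R ^+ 2 * (16 * (c ^+ 2 * (4 * n + 1)%:R)))).
  by rewrite !ler_wpM2l// ?sqr_ge0.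
rewrite [leLHS](_ : _ = (n.+1%:R ^+ 2 * 16 * (4 * n + 1)%:R) * c ^+ 2); last by ring.
rewrite [leRHS](_ : _ = ((4 * n + 2)%:R ^+ 2 * (4 * n.+1 + 1)%:R) * c ^+ 2); last by ring.
rewrite ler_wpM2r//.
by rewrite -subr_ge0 [leRHS](_ : _ = 4); last by ring.
Qed.

End real_combinatorics.

(** * The shift between levels *)

Definition level_shift (C : nmodType) (h : nat -> C) (k : nat) : C :=
  h k + h k.+1.

Section level_shift_theory.
Context {C : nmodType}.
Implicit Types h g : nat -> C.

Lemma eq_iter_level_shift n h g i :
  (forall k, (i <= k <= i + n)%N -> h k = g k) ->
  iter n (@level_shift C) h i = iter n (@level_shift C) g i.
Proof.
elim: n i => [|n IHn] i hg /=; first by apply: hg; rewrite addn0 leqnn.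
rewrite /level_shift; congr (_ + _); apply: IHn => k /andP[ik kn]; apply: hg.
  by rewrite ik (leq_trans kn)// leq_add2l.
by rewrite (ltnW ik) addnS -addSn.
Qed.

End level_shift_theory.

Section level_shift_linear.
Context {A : comPzRingType}.
Implicit Types h g : nat -> A.

Lemma iter_level_shift_lin n (c : A) h g i :
  iter n (@level_shift A) (fun k => h k + c * g k) i =
  iter n (@level_shift A) h i + c * iter n (@level_shift A) g i.
Proof.
elim: n i => [//|n IHn] i /=.
by rewrite /level_shift !IHn; ring.
Qed.

End level_shift_linear.

(** * Polynomials as functionals on sequences *)

Section pairing.
Context {R A : comNzRingType} (phi : {rmorphism R -> A}).
Implicit Types (p : {poly R}) (h : nat -> A).

(** The morphism [phi] lets real polynomials act both on complex sequences, through the embedding,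
    and on real ones, through the identity. *)
Definition pairing N p h : A := \sum_(k < N.+1) phi p`_k * h k.

Lemma pairing_level_shift N p h : (size p <= N.+1)%N ->
  pairing N p (@level_shift A h) = pairing N.+1 ((1 + 'X) * p) h.
Proof.
move=> sp; rewrite /pairing.
transitivity (\sum_(k < N.+1) phi p`_k * h k + \sum_(k < N.+1) phi p`_k * h k.+1).
  by rewrite -big_split; apply: eq_bigr => k _; rewrite mulrDr.
transitivity (\sum_(k < N.+2) phi p`_k * h k +
    \sum_(k < N.+2) phi ('X * p)`_k * h k); last first.
  by rewrite -big_split; apply: eq_bigr => k _ /=; rewrite mulrDl mul1r coefD rmorphD mulrDl.
congr (_ + _).
  by rewrite [RHS]big_ord_recr /= nth_default// rmorph0 mul0r addr0.
rewrite [RHS]big_ord_recl coefXM eqxx rmorph0 mul0r add0r.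
by apply: eq_bigr => k _; rewrite coefXM.
Qed.

Lemma size_1DX_mul p N : (size p <= N.+1)%N -> (size ((1 + 'X) * p)%R <= N.+2)%N.
Proof.
move=> sp; apply: leq_trans (size_polyMleq _ _) _.
by rewrite addrC size_XaddC addSn /= add1n ltnS.
Qed.

Lemma pairing_iter_level_shift n N p h : (size p <= N.+1)%N ->
  pairing N p (iter n (@level_shift A) h) = pairing (N + n) ((1 + 'X) ^+ n * p) h.
Proof.
elim: n N p h => [|n IHn] N p h sp; first by rewrite addn0 mul1r.
rewrite iterS pairing_level_shift// IHn ?size_1DX_mul// addnS addSn.
by rewrite mulrA -exprSr.
Qed.

End pairing.

(** * Squared norms of the coefficients of [(1 - X) ^ q (1 + X) ^ n] *)

Section binomial_energy.
Context {R : realType}.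
Implicit Types p : {poly R}.

Definition energy p N : R := \sum_(k < N.+1) p`_k ^+ 2.

Lemma energy_ge0 p N : 0 <= energy p N.
Proof. by apply: sumr_ge0 => k _; exact: sqr_ge0. Qed.

(** The parallelogram identity for each pair of coefficients of [p] and ['X * p]; both polynomials
    have the same energy. *)
Lemma energy_parallelogram p N : (size p <= N.+1)%N ->
  energy ((1 - 'X) * p) N.+1 + energy ((1 + 'X) * p) N.+1 = 4 * energy p N.
Proof.
move=> sp; rewrite /energy -big_split /=.
rewrite (eq_bigr (fun k : 'I_N.+2 => 2 * p`_k ^+ 2 + 2 * ('X * p)`_k ^+ 2)); last first.
  by move=> k _; rewrite mulrBl mulrDl mul1r coefB coefD; ring.
rewrite big_split /=.
rewrite big_ord_recr /= (nth_default _ sp) expr0n/= mulr0 addr0.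
rewrite [X in _ + X]big_ord_recl coefXM eqxx expr0n/= mulr0 add0r.
rewrite mulr_sumr -big_split /=; apply: eq_bigr => k _.
by rewrite coefXM/=; ring.
Qed.

Lemma size_1BXn1DXn q n : (size ((1 - 'X) ^+ q * (1 + 'X) ^+ n : {poly R})%R <= (q + n).+1)%N.
Proof.
have s1 : size (1 - 'X : {poly R}) = 2%N by rewrite -opprB size_polyN size_XsubC.
have s2 : size (1 + 'X : {poly R}) = 2%N by rewrite addrC size_XaddC.
apply: leq_trans (size_polyMleq _ _) _.
have := size_poly_exp_leq (1 - 'X : {poly R}) q; have := size_poly_exp_leq (1 + 'X : {poly R}) n.
rewrite s1 s2 /= !mul1n; set a := size _; set b := size _.
lia.
Qed.

Definition bin_energy q n : R := energy ((1 - 'X) ^+ q * (1 + 'X) ^+ n) (q + n).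

Lemma bin_energy_parallelogram q n :
  bin_energy q.+1 n + bin_energy q n.+1 = 4 * bin_energy q n.
Proof.
rewrite -energy_parallelogram ?size_1BXn1DXn// /bin_energy addSn addnS.
by rewrite !exprS !mulrA [(1 + 'X) * _]mulrC.
Qed.

Lemma bin_energy0 n : bin_energy 0 n = 'C(n.*2, n)%:R.
Proof.
rewrite /bin_energy /energy expr0 mul1r add0n -addnn -binomial.Vandermonde natr_sum.
apply: eq_bigr => k _; rewrite coef_1DXn natrM bin_sub ?expr2//.
by rewrite -ltnS.
Qed.

(** The parallelogram relation converts a recursion in [n] into one in [q], because
    [4 (q + n + 1) - (4 n + 2) = 4 q + 2]. *)
Lemma bin_energy_exchange q n :
  (q + n).+1%:R * bin_energy q n.+1 = (4 * n + 2)%:R * bin_energy q n ->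
  (q + n).+1%:R * bin_energy q.+1 n = (4 * q + 2)%:R * bin_energy q n.
Proof.
move=> e.
have -> : bin_energy q.+1 n = 4 * bin_energy q n - bin_energy q n.+1.
  by rewrite -bin_energy_parallelogram addrK.
by rewrite mulrBr e -!(natr1, natrD, natrM); ring.
Qed.

(** Induction on [q] from the central binomial case. The exchange at [n] and at [n.+1] expresses
    both sides through [bin_energy q], where the recursion is already known; a common factor
    [(q + n).+1] is then cancelled. *)
Lemma bin_energy_succr q n :
  (q + n).+1%:R * bin_energy q n.+1 = (4 * n + 2)%:R * bin_energy q n.
Proof.
elim: q n => [|q IHq] n; first by rewrite add0n !bin_energy0 central_bin_succ.
have D m := bin_energy_exchange (IHq m).
apply: (@mulfI _ (q + n).+1%:R); first by rewrite pnatr_eq0.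
have D1 := D n.+1; rewrite addnS in D1.
by rewrite addSn D1 mulrCA IHq mulrCA -D mulrCA.
Qed.

Lemma bin_energy_succl q n :
  (q + n).+1%:R * bin_energy q.+1 n = (4 * q + 2)%:R * bin_energy q n.
Proof. exact/bin_energy_exchange/bin_energy_succr. Qed.

(** This is the square of the factor [(n + 1) ^ (q/2 + 1/4) / 2 ^ n] of the theorem, with the half
    power as a square root so that the estimates stay algebraic. *)
Definition rate q n : R := n.+1%:R ^+ q * Num.sqrt n.+1%:R / 4 ^+ n.

Lemma rate_gt0 q n : 0 < rate q n.
Proof. by rewrite /rate divr_gt0 ?mulr_gt0 ?sqrtr_gt0 ?exprn_gt0 ?ltr0n. Qed.

Lemma rateS q n : rate q.+1 n = n.+1%:R * rate q n.
Proof. by rewrite /rate exprS !mulrA. Qed.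

Lemma rate_le q q' n : (q <= q')%N -> rate q n <= rate q' n.
Proof.
move=> /subnK <-; elim: (q' - q)%N => [//|m IHm].
apply: (le_trans IHm); rewrite addSn rateS ler_peMl ?(ltW (rate_gt0 _ _))//.
by rewrite ler1n.
Qed.

(** Here [n + 2 <= 2 (n + 1)] accounts for [2 ^ q], and the new factor [1/4] absorbs the growth of
    the square root. *)
Lemma rate_succ_le q n : rate q n.+1 <= 2 ^+ q * rate q n.
Proof.
have n0 : (0 : R) <= n%:R by rewrite ler0n.
rewrite /rate [4 ^+ n.+1]exprS invfM.
apply: (@le_trans _ _ ((2 ^+ q * n.+1%:R ^+ q) * (2 * Num.sqrt n.+1%:R) * (4^-1 / 4 ^+ n))).
  apply: ler_wpM2r; first by rewrite mulr_ge0 ?invr_ge0 ?exprn_ge0.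
  apply: ler_pM; rewrite ?exprn_ge0 ?sqrtr_ge0//.
    by rewrite -exprMn lerXn2r ?nnegrE// -!natr1; lra.
  have -> : 2 * Num.sqrt n.+1%:R = Num.sqrt (4 * n.+1%:R) :> R.
    by rewrite (_ : 4 = 2 ^+ 2) -?natrX// natrX sqrtrM ?sqr_ge0// sqrtr_sqr ger0_norm.
  by rewrite ler_wsqrtr// -!natr1; lra.
rewrite [leLHS](_ : _ = 2^-1 * (2 ^+ q * (n.+1%:R ^+ q * Num.sqrt n.+1%:R / 4 ^+ n))); last by field; rewrite expf_neq0.
by rewrite ler_piMl ?(mulr_ge0, divr_ge0, exprn_ge0, sqrtr_ge0)//; lra.
Qed.

(** Raising [q] multiplies [rate] by [n + 1], which the denominator [(q + n).+1] of
    [bin_energy_succl] absorbs. *)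
Lemma bin_energy_rate q : exists2 C : R, 0 < C & forall n, bin_energy q n * rate q n <= C.
Proof.
elim: q => [|q [C C0 IH]].
  exists 1 => // n; rewrite bin_energy0 /rate expr0 mul1r mulrA.
  rewrite ler_pdivrMr ?exprn_gt0// mul1r.
  rewrite -(@ler_pXn2r _ 2)// ?nnegrE ?mulr_ge0 ?sqrtr_ge0 ?exprn_ge0//.
  rewrite exprMn sqr_sqrtr// -exprM mulnC exprM (_ : 4 ^+ 2 = 16 :> R); last by rewrite -natrX.
  exact: central_bin_ub.
exists ((4 * q + 2)%:R * C) => [|n]; first by rewrite mulr_gt0// ltr0n addn2.
rewrite rateS mulrA.
apply: (@le_trans _ _ ((q + n).+1%:R * bin_energy q.+1 n * rate q n)).
  rewrite ler_wpM2r ?(ltW (rate_gt0 _ _))// mulrC ler_wpM2r ?energy_ge0//.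
  by rewrite ler_nat ltnS leq_addl.
by rewrite bin_energy_succl -mulrA ler_wpM2l.
Qed.

Lemma sum_sqr_CS (n : nat) (a b : nat -> R) :
  (\sum_(k < n) a k * b k) ^+ 2 <= (\sum_(k < n) a k ^+ 2) * (\sum_(k < n) b k ^+ 2).
Proof.
elim: n => [|n IHn]; first by rewrite !big_ord0 expr0n mul0r.
rewrite !big_ord_recr/=.
move: IHn; set x := \sum_(k < n) _; set S := \sum_(k < n) _; set T := \sum_(k < n) _.
have S0 : 0 <= S by apply: sumr_ge0 => k _; exact: sqr_ge0.
have T0 : 0 <= T by apply: sumr_ge0 => k _; exact: sqr_ge0.
move: (a n) (b n) => u v xST.
(* The cross term: after squaring and using the induction hypothesis, the difference of the two
   sides is at least a square. *)
have : 2 * x * (u * v) <= S * v ^+ 2 + T * u ^+ 2.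
  have p0 : 0 <= S * v ^+ 2 + T * u ^+ 2 by rewrite addr_ge0// mulr_ge0 ?sqr_ge0.
  apply: le_trans (ler_norm _) _.
  rewrite -(@ler_pXn2r _ 2)// ?nnegrE// real_normK ?num_real//.
  apply: (@le_trans _ _ (4 * (S * T) * (u * v) ^+ 2)).
    rewrite [leLHS](_ : _ = 4 * x ^+ 2 * (u * v) ^+ 2); last by ring.
    by rewrite ler_wpM2r ?sqr_ge0// ler_wpM2l.
  rewrite -subr_ge0 [leRHS](_ : _ = (S * v ^+ 2 - T * u ^+ 2) ^+ 2) ?sqr_ge0//; ring.
move=> h; have -> : (x + u * v) ^+ 2 = x ^+ 2 + 2 * x * (u * v) + (u * v) ^+ 2 by ring.
have -> : (S + u ^+ 2) * (T + v ^+ 2) = S * T + (S * v ^+ 2 + T * u ^+ 2) + (u * v) ^+ 2 by ring.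
by rewrite lerD2r lerD.
Qed.

Lemma normc_sum n (z : nat -> R[i]) : normc (\sum_(k < n) z k) <= \sum_(k < n) normc (z k).
Proof.
elim: n => [|n IHn]; first by rewrite !big_ord0 normc0.
by rewrite !big_ord_recr/=; apply: le_trans (le_normcD _ _) _; rewrite lerD2r.
Qed.

Lemma normc_real (x : R) : normc x%:C = `|x|.
Proof. by rewrite /= expr0n/= addr0 sqrtr_sqr. Qed.

Definition level_energy N (h : nat -> R[i]) : R := \sum_(k < N.+1) normc (h k) ^+ 2.

Lemma level_energy_ge0 N h : 0 <= level_energy N h.
Proof. by apply: sumr_ge0 => k _; exact: sqr_ge0. Qed.

Lemma normc_pairing_le N p (h : nat -> R[i]) :
  normc (pairing (@real_complex R) N p h) ^+ 2 <= energy p N * level_energy N h.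
Proof.
have -> : energy p N = \sum_(k < N.+1) `|p`_k| ^+ 2.
  by apply: eq_bigr => k _; rewrite real_normK ?num_real.
apply: le_trans (sum_sqr_CS N.+1 (fun k => `|p`_k|) (fun k => normc (h k))).
rewrite lerXn2r ?nnegrE ?normc_ge0//.
  by apply: sumr_ge0 => k _; rewrite mulr_ge0 ?normc_ge0.
apply: le_trans (normc_sum _ (fun k => (p`_k)%:C * h k)) _.
by apply: ler_sum => k _; rewrite normcM normc_real.
Qed.

End binomial_energy.

(** * Small preimages *)

Section preimages.
Context {R : realType}.

(** Not only its adjoint but the level shift itself multiplies by [1 + X], up to an index:
    [p_i + p_(i+1)] is the coefficient of degree [i + 1] of [(1 + X) p]. *)
Lemma iter_level_shift_coef m (p : {poly R}) i :
  iter m (@level_shift R) (fun k => p`_k) i = ((1 + 'X) ^+ m * p)`_(i + m).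
Proof.
elim: m i => [|m IHm] i; first by rewrite addn0 expr0 mul1r.
rewrite iterS /level_shift !IHm exprS -mulrA [in RHS]mulrDl mul1r coefD coefXM.
by rewrite addnS addSn/= addrC.
Qed.

(* Up to signs, [(1 + X) ^ n * alt_poly q n] lists the values on [{0, ..., n + q}]
   of the discrete Chebyshev polynomial of degree [n]. *)
Definition alt_poly q n : {poly R} :=
  \poly_(l < q.+1) ((-1) ^+ l * ('C(n + l, n) * 'C(n + q - l, n))%:R).

(** The convolution, reindexed by [l = i + n - j], is an alternating binomial sum of order [n.*2]
    with [a = b = n]. *)
Lemma coef_alt_poly q n i : (i <= q)%N ->
  ((1 + 'X) ^+ n.*2 * alt_poly q n)`_(i + n) = (-1) ^+ i * 'C(n.*2, n)%:R.
Proof.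
move=> iq; pose T j : R := (-1) ^+ (i + n) * ((-1) ^+ j * 'C(n.*2, j)%:R *
  ('C(q - i + j, n) * 'C(i + n.*2 - j, n))%:R).
transitivity (\sum_(j < (i + n.*2).+1) T j).
  (* Where [l] leaves the range [0..q], a binomial coefficient in [T j] vanishes, so both sums have
     the same nonzero terms. *)
  rewrite coefM (big_ord_widen (i + n.*2).+1 (fun j =>
    ((1 + 'X) ^+ n.*2)`_j * (alt_poly q n)`_(i + n - j))); last by rewrite ltnS leq_add2l -addnn leq_addr.
  rewrite big_mkcond; apply: eq_bigr => -[j /= jlt] _.
  rewrite coef_1DXn coef_poly /T ltnS.
  have [jin|jin] := leqP j (i + n).
    case: ltnP => [h|h].
      have -> : (n + (i + n - j) = i + n.*2 - j)%N by lia.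
      have -> : (n + q - (i + n - j) = q - i + j)%N by lia.
      have -> : (-1) ^+ (i + n - j) = (-1) ^+ (i + n) * (-1) ^+ j :> R.
        by rewrite -{2}(subnK jin) exprD -mulrA -expr2 sqrr_sign mulr1.
      by rewrite !natrM; ring.
    rewrite mulr0 (bin_small (_ : q - i + j < n)%N) ?mul0n ?mulr0//; lia.
  have [n0|n0] := posnP n.
    by rewrite n0 bin_small ?mulr0 ?mul0r//; lia.
  by rewrite [X in (_ * X)%N]bin_small ?muln0 ?mulr0//; lia.
transitivity (\sum_(j < n.*2.+1) T j).
  rewrite [RHS](big_ord_widen (i + n.*2).+1 T) ?ltnS ?leq_addl// [RHS]big_mkcond.
  apply: eq_bigr => -[j /= jlt] _; rewrite /T ltnS; case: leqP => // nj.
  by rewrite (bin_small nj) mulr0 mul0r mulr0.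
rewrite /T -mulr_sumr alternating_bin_sum ?addnn ?leq_addl//.
by rewrite exprD mulrA -[_ * _ * (-1) ^+ n]mulrA -expr2 sqrr_sign mulr1.
Qed.

(** Passing from [l] to [l.+1] multiplies the binomial by [(n + l + 1) / (l + 1)], which is at most
    [n + 1]. *)
Lemma bin_add_le n l : ('C(n + l, n) <= n.+1 ^ l)%N.
Proof.
elim: l => [|l IHl]; first by rewrite addn0 binn.
have := mul_bin_down (n + l).+1 n; rewrite -addnS addnS /= -addnS addKn => e.
rewrite -(leq_pmul2l (ltn0Sn l)) -e expnS mulnA addnS.
by apply: leq_mul => //; nia.
Qed.

(** The witness [G] lies in the range of the adjoint of the [n]-th iterate, so it is the preimage of
    least norm. *)
Lemma alt_preimage q n : exists h : nat -> R,
  (forall i, (i <= q)%N -> iter n (@level_shift R) h i = (-1) ^+ i) /\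
  \sum_(k < (q + n).+1) h k ^+ 2 <= 2 * q.+1%:R * rate q n.
Proof.
set c : R := 'C(n.*2, n)%:R.
have c0 : 0 < c by rewrite ltr0n bin_gt0 -addnn leq_addr.
pose G := c^-1 *: ((1 + 'X) ^+ n * alt_poly q n).
have hG i : (i <= q)%N -> iter n (@level_shift R) (fun k => G`_k) i = (-1) ^+ i.
  move=> iq; rewrite iter_level_shift_coef /G -scalerAr coefZ mulrA -exprD addnn.
  by rewrite coef_alt_poly// mulrC mulfK ?gt_eqF.
exists (fun k => G`_k); split=> //.
(* By adjointness the squared norm of [G] becomes [c^-1] times the pairing of [alt_poly q n] with
   the alternating vector, where all signs cancel. *)
have -> : \sum_(k < (q + n).+1) G`_k ^+ 2 =
    c^-1 * pairing idfun (q + n) ((1 + 'X) ^+ n * alt_poly q n) (fun k => G`_k).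
  rewrite /pairing mulr_sumr; apply: eq_bigr => k _; rewrite expr2 /G coefZ /=; ring.
rewrite -pairing_iter_level_shift ?size_poly// /pairing.
have -> : \sum_(k < q.+1) idfun (alt_poly q n)`_k *
   iter n (@level_shift R) (fun k => G`_k) k =
   \sum_(k < q.+1) ('C(n + k, n) * 'C(n + q - k, n))%:R.
  apply: eq_bigr => k _; rewrite hG -1?ltnS//= coef_poly ltn_ord.
  by rewrite mulrAC -expr2 sqrr_sign mul1r.
apply: (@le_trans _ _ (c^-1 * \sum_(k < q.+1) n.+1%:R ^+ q)).
  rewrite ler_wpM2l ?invr_ge0 ?(ltW c0)//; apply: ler_sum => k _.
  have kq : (k <= q)%N by rewrite -ltnS.
  rewrite -natrX ler_nat -[X in (_ ^ X)%N](subnKC kq) expnD leq_mul ?bin_add_le//.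
  by rewrite -addnBA// bin_add_le.
rewrite sumr_const card_ord -[_ *+ q.+1]mulr_natl /rate.
(* This is [central_bin_lb] with [4 n + 1 <= 4 (n + 1)]. *)
have hc : c^-1 <= 2 * Num.sqrt n.+1%:R / 4 ^+ n.
  rewrite ler_pdivlMr ?exprn_gt0// mulrC ler_pdivrMr//.
  rewrite -(@ler_pXn2r _ 2)// ?nnegrE ?mulr_ge0 ?sqrtr_ge0 ?exprn_ge0 ?(ltW c0)//.
  rewrite -exprM mulnC exprM (_ : 4 ^+ 2 = 16); last by rewrite -natrX.
  rewrite !exprMn sqr_sqrtr//; apply: le_trans (central_bin_lb n) _.
  rewrite mulrC -/c ler_wpM2r ?sqr_ge0// -natrX -natrM ler_nat; lia.
apply: le_trans (ler_wpM2r _ hc) _; first by rewrite mulr_ge0 ?exprn_ge0.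
by rewrite le_eqVlt; apply/orP; left; apply/eqP; ring.
Qed.

Lemma iter_level_shift_real n (h : nat -> R) i :
  iter n (@level_shift R[i]) (fun k => (h k)%:C) i = (iter n (@level_shift R) h i)%:C.
Proof. by elim: n i => [//|n IHn] i /=; rewrite /level_shift !IHn -rmorphD. Qed.

Lemma normc_sqrD (x y : R[i]) : normc (x + y) ^+ 2 <= 2 * normc x ^+ 2 + 2 * normc y ^+ 2.
Proof.
apply: (@le_trans _ _ ((normc x + normc y) ^+ 2)).
  by rewrite lerXn2r ?nnegrE ?addr_ge0 ?normc_ge0//; exact: le_normcD.
rewrite -subr_ge0 [leRHS](_ : _ = (normc x - normc y) ^+ 2) ?sqr_ge0//; ring.
Qed.

Lemma level_energyD_le N (z : R[i]) (h : nat -> R[i]) (h0 : nat -> R) :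
  level_energy N (fun k => h k + z * (h0 k)%:C) <=
  2 * level_energy N h + 2 * normc z ^+ 2 * \sum_(k < N.+1) h0 k ^+ 2.
Proof.
rewrite /level_energy !mulr_sumr -big_split; apply: ler_sum => k _ /=.
apply: le_trans (normc_sqrD _ _) _.
by rewrite lerD2l normcM normc_real exprMn real_normK ?num_real// -[leRHS]mulrA.
Qed.

(* If [L ^ (n + 1) h = L g] then [L ^ n h - g] lies in the kernel of [L], hence
   is a multiple of the alternating vector; its size is read off by pairing with
   [(1 - X) ^ (q + 1)], which [L ^ n] damps by the additional factor needed. *)
Lemma level_preimage q (g : nat -> R[i]) : exists2 C : R, 0 <= C &
  forall n, exists h : nat -> R[i],
    (forall i, (i <= q)%N -> iter n (@level_shift R[i]) h i = g i) /\
    level_energy (q + n) h <= C * rate q n.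
Proof.
elim: q g => [|q IHq] g.
  exists (2 * normc (g 0%N) ^+ 2 * 2); first by rewrite ?(sqr_ge0, mulr_ge0).
  move=> n; have [h0 [h0i h0E]] := alt_preimage 0 n.
  exists (fun k => 0 + g 0%N * (h0 k)%:C); split=> [i|].
    rewrite leqn0 => /eqP ->.
    rewrite (iter_level_shift_lin _ _ (fun=> 0)) (iter_level_shift_real _ h0) h0i// mulr1.
    rewrite [X in X + _](_ : _ = 0) ?add0r//.
    by elim: n {h0 h0i h0E} 0%N => [//|n IHn] j /=; rewrite /level_shift !IHn addr0.
  apply: le_trans (level_energyD_le _ _ (fun=> 0) _) _.
  rewrite [level_energy _ _]big1 ?mulr0 ?add0r => [|k _]; last by rewrite normc0 expr0n.
  rewrite -[leRHS]mulrA ler_wpM2l ?(sqr_ge0, mulr_ge0)//.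
  by move: h0E; rewrite mulr1.
have [C0 C00 H] := IHq (@level_shift R[i] g).
have [C1 C10 E1] := bin_energy_rate (R := R) q.+1.
set p : {poly R} := (1 - 'X) ^+ q.+1.
have sp : (size p <= q.+2)%N by have := @size_1BXn1DXn R q.+1 0; rewrite expr0 mulr1 addn0.
have p_alt : p.[-1] = 2 ^+ q.+1.
  by rewrite /p horner_exp !hornerE opprK.
pose b := normc (pairing (@real_complex R) q.+1 p g) ^+ 2.
have b0 : 0 <= b by exact: sqr_ge0.
(* The constant [L], independent of [n], will bound the squared modulus of [d 0%N]: its two terms
   come from the pairings of [p] with the [n]-th iterate of [h] and with [g]. *)
pose L := 2 * (C1 * (C0 * 2 ^+ q)) + 2 * b.
have L0 : 0 <= L.
  by apply: addr_ge0; rewrite mulr_ge0 // mulr_ge0 ?(ltW C10) // mulr_ge0 ?exprn_ge0.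
exists (2 * (C0 * 2 ^+ q) + 2 * L * (2 * q.+2%:R)).
  by apply: addr_ge0; rewrite mulr_ge0 // ?(mulr_ge0, exprn_ge0).
move=> n; have [h [hi hE]] := H n.+1.
have [h0 [h0i h0E]] := alt_preimage q.+1 n.
have r0 := rate_gt0 (R := R) q n.
have rS : rate q n <= rate q.+1 n :> R by exact: rate_le.
have hE' : level_energy (q.+1 + n) h <= C0 * 2 ^+ q * rate q n.
  rewrite addSnnS; apply: (le_trans hE).
  by rewrite -mulrA ler_wpM2l ?rate_succ_le.
pose d i := iter n (@level_shift R[i]) h i - g i.
have dalt i : (i <= q.+1)%N -> d i = d 0%N * (-1) ^+ i.
  elim: i => [_|i IHi iq]; first by rewrite mulr1.
  have e := hi i iq; rewrite iterS in e.
  have : d i + d i.+1 = 0.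
    by rewrite /d addrACA -opprD; apply/eqP; rewrite subr_eq0; apply/eqP.
  rewrite (IHi (ltnW iq)) exprS => /eqP; rewrite addrC addr_eq0 => /eqP ->.
  by rewrite mulN1r mulrN.
(* Pairing with the alternating vector evaluates a polynomial at [-1], where [p] does not vanish. *)
have dpair : pairing (@real_complex R) (q.+1 + n) ((1 + 'X) ^+ n * p) h -
    pairing (@real_complex R) q.+1 p g = d 0%N * (2 ^+ q.+1)%:C.
  rewrite -pairing_iter_level_shift// -p_alt (horner_coef_wide _ sp) rmorph_sum mulr_sumr.
  rewrite /pairing -sumrB; apply: eq_bigr => i _.
  have iq : (i <= q.+1)%N by rewrite -ltnS.
  by rewrite -mulrBr -/(d i) dalt// rmorphM rmorphXn rmorphN1 mulrCA mulrA.
have dL : normc (d 0%N) ^+ 2 <= L.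
  apply: (@le_trans _ _ (normc (d 0%N * (2 ^+ q.+1)%:C) ^+ 2)).
    rewrite normcM normc_real lerXn2r ?nnegrE ?mulr_ge0 ?normc_ge0//.
    rewrite ler_peMr ?normc_ge0// ger0_norm ?exprn_ge0//.
    by rewrite exprn_ege1// ler1n.
  rewrite -dpair; apply: le_trans (normc_sqrD _ _) _.
  rewrite normcN lerD2r ler_wpM2l//; apply: le_trans (normc_pairing_le _ _ _) _.
  rewrite [_ * p]mulrC -/(bin_energy q.+1 n).
  apply: le_trans (ler_wpM2l (energy_ge0 _ _) hE') _.
  rewrite mulrCA [leRHS]mulrC ler_wpM2l ?mulr_ge0 ?exprn_ge0//.
  by apply: le_trans (E1 n); rewrite ler_wpM2l ?energy_ge0.
exists (fun k => h k + - d 0%N * (h0 k)%:C); split=> [i iq|].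
  rewrite iter_level_shift_lin iter_level_shift_real h0i// rmorphXn rmorphN1.
  by rewrite mulNr -dalt// /d opprB addrC subrK.
apply: le_trans (level_energyD_le _ _ _ _) _.
rewrite normcN [leRHS]mulrDl; apply: lerD.
  rewrite -[leRHS]mulrA ler_wpM2l//; apply: (le_trans hE').
  by rewrite ler_wpM2l ?mulr_ge0 ?exprn_ge0.
apply: (@le_trans _ _ (2 * L * \sum_(k < (q.+1 + n).+1) h0 k ^+ 2)).
  by rewrite ler_wpM2r ?ler_wpM2l// sumr_ge0// => k _; exact: sqr_ge0.
by rewrite -[leRHS]mulrA ler_wpM2l ?mulr_ge0.
Qed.

End preimages.

(** * Level decomposition of the weighted space *)

(** Only the indices [k <= N] are meaningful; beyond them truncated subtraction yields
    [f (k, 0)]. *)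
Definition level (C : Type) (N : nat) (f : nat * nat -> C) (k : nat) : C :=
  f (k, (N - k)%N).

Lemma iter_backward_shift (C : nmodType) n (f : nat * nat -> C) i j :
  iter n (@backward_shift C) f (i, j) =
  iter n (@level_shift C) (level (i + j + n) f) i.
Proof.
elim: n f => [|n IHn] f; first by rewrite /= /level addn0 addKn.
(* A level of [backward_shift f] is the level shift of the next level of [f] only at meaningful
   indices, hence the appeal to locality. *)
rewrite iterSr IHn [in RHS]iterSr; apply: eq_iter_level_shift => k /andP[_ kn].
rewrite /level backward_shiftE /level_shift addnS subSS -subSn 1?addrC//.
by rewrite (leq_trans kn)// leq_add2r leq_addr.
Qed.

Lemma tail_bounded_series (R : realType) (u : nat -> R) (K : R) :
  (forall n, 0 <= u n) -> (forall n, \sum_(k < n) u k <= K) ->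
  forall e, 0 < e -> exists D, forall n, (D <= n)%N ->
    \sum_(k < n) u k - \sum_(k < D) u k <= e.
Proof.
move=> u0 uK e e0.
have hs : has_sup [set \sum_(k < n) u k | n in [set: nat]].
  split; first by exists (\sum_(k < 0) u k), 0%N.
  by exists K => _ [n _ <-].
have [_ [D _ <-] De] := sup_adherent e0 hs.
exists D => n Dn; rewrite lerBlDr; apply/ltW.
apply: (@le_lt_trans _ _ (sup [set \sum_(k < n) u k | n in [set: nat]])).
  by apply: ub_le_sup; [exact: (proj2 hs)|exists n].
by rewrite addrC -ltrBlDr.
Qed.

Section lattice_l2.
Context {R : realType} (omega : nat -> R[i]).
Implicit Types f g : nat * nat -> R[i].

Definition weight N : R := normc (omega N) ^+ 2.

Definition level_sqnorm f N : R := weight N * level_energy N (level N f).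

Lemma weight_ge0 N : 0 <= weight N.
Proof. exact: sqr_ge0. Qed.

Lemma level_sqnorm_ge0 f N : 0 <= level_sqnorm f N.
Proof. by rewrite mulr_ge0 ?weight_ge0 ?level_energy_ge0. Qed.

Lemma eq_level_sqnorm f g N : (forall v, (v.1 + v.2)%N = N -> f v = g v) ->
  level_sqnorm f N = level_sqnorm g N.
Proof.
move=> fg; congr (_ * _); apply: eq_bigr => k _; rewrite /level fg//=.
by rewrite subnKC// -ltnS.
Qed.

Lemma level_sqnorm0 f N : (forall v, (v.1 + v.2)%N = N -> f v = 0) ->
  level_sqnorm f N = 0.
Proof.
move=> f0; rewrite /level_sqnorm [level_energy _ _]big1 ?mulr0// => k _.
by rewrite /level f0 ?normc0 ?expr0n//= subnKC// -ltnS.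
Qed.

(** The triangles are cofinal among the finite subsets of the lattice; this turns the [esum] over
    vertices into a series over levels. *)
Let triangle D : seq (nat * nat) :=
  [seq (k, (N - k)%N) | N <- iota 0 D, k <- iota 0 N.+1].

Let mem_triangle D v : (v \in triangle D) = (v.1 + v.2 < D)%N.
Proof.
apply/allpairsPdep/idP => [[N [k []]]|vD].
  rewrite !mem_iota /= ?add0n => ND; rewrite ltnS => kN ->/=.
  by rewrite subnKC.
exists (v.1 + v.2)%N, v.1; rewrite !mem_iota /= ?add0n ltnS leq_addr vD.
by rewrite addKn; split=> //; case: v {vD}.
Qed.

Let uniq_triangle D : uniq (triangle D).
Proof.
apply: allpairs_uniq_dep; [exact: iota_uniq|by move=> *; exact: iota_uniq|].
move=> p q /allpairsPdep[N [k [_ + ->]]] /allpairsPdep[N' [k' [_ + ->]]] /=.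
rewrite !mem_iota /= ?add0n !ltnS => kN kN' [kk' NN'].
by subst k'; have -> : N = N' by rewrite -(subnKC kN) NN' subnKC.
Qed.

Let sum_triangle f D :
  (\sum_(v \in [set` triangle D]) (normc (lattice_weight omega v * f v) ^+ 2)%:E)%E =
  (\sum_(N < D) level_sqnorm f N)%:E.
Proof.
rewrite -fsbig_seq ?uniq_triangle// sumEFin; congr _%:E.
rewrite big_allpairs_dep -(big_mkord xpredT (level_sqnorm f)) /index_iota subn0.
apply: eq_big_seq => N _.
rewrite /level_sqnorm /level_energy mulr_sumr.
rewrite -(big_mkord xpredT (fun k => weight N * normc (level N f k) ^+ 2)) /index_iota subn0.
apply: eq_big_seq => k; rewrite mem_iota /= ?add0n ltnS => kN.
by rewrite normcM exprMn /lattice_weight /= subnKC.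
Qed.

Lemma l2_sqnorm_ge f D :
  ((\sum_(N < D) level_sqnorm f N)%:E <= l2_sqnorm (lattice_weight omega) f)%E.
Proof.
apply: esum_ge; exists [set` triangle D]; last by rewrite sum_triangle.
by split=> //; exact: finite_seq.
Qed.

Lemma l2_sqnorm_le f (K : R) : (forall D, \sum_(N < D) level_sqnorm f N <= K) ->
  (l2_sqnorm (lattice_weight omega) f <= K%:E)%E.
Proof.
move=> fK; apply: ge_ereal_sup => _ [A [finA _] <-].
have /finite_seqP[s As] := finA.
pose D := (\max_(v <- s) (v.1 + v.2)).+1.
apply: (@le_trans _ _ (\sum_(N < D) level_sqnorm f N)%:E); last by rewrite lee_fin.
rewrite -sum_triangle; apply: lee_fsum_nneg_subset => //.
- exact: finite_seq.
- move=> v; rewrite !inE As /= => vs; rewrite mem_triangle ltnS.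
  by apply: (@leq_bigmax_seq _ s xpredT (fun v => v.1 + v.2)%N v).
- by move=> v _; rewrite lee_fin sqr_ge0.
Qed.

Hypothesis omega_neq0 : forall n, omega n != 0.
Local Notation X := (l2 (lattice_weight_neq0 omega_neq0)).
Implicit Types x y : X.

Lemma weight_gt0 N : 0 < weight N.
Proof.
rewrite exprn_gt0// lt_neqAle normc_ge0 andbT eq_sym.
by apply: contra (omega_neq0 N) => /eqP/eq0_normc ->.
Qed.

Lemma l2_of_level_bound f (K : R) : (forall D, \sum_(N < D) level_sqnorm f N <= K) ->
  exists x : X, forall v, x v = f v.
Proof.
move=> fK; suff fP : f \in l2_pred (lattice_weight omega) by exists (L2 _ fP).
by rewrite /in_mem /= /l2_pred; apply: le_lt_trans (l2_sqnorm_le fK) _; rewrite ltry.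
Qed.

Lemma l2_of_finite_levels f D : (forall v, (D <= v.1 + v.2)%N -> f v = 0) ->
  exists x : X, forall v, x v = f v.
Proof.
move=> f0; apply: (@l2_of_level_bound _ (\sum_(N < D) level_sqnorm f N)) => n.
have z k : (D <= k)%N -> level_sqnorm f k = 0.
  by move=> Dk; apply: level_sqnorm0 => v vk; apply: f0; rewrite vk.
have [nD|Dn] := leqP n D.
  rewrite -(subnKC nD) big_split_ord /= lerDl sumr_ge0// => k _.
  exact: level_sqnorm_ge0.
rewrite -(subnKC (ltnW Dn)) big_split_ord /= [X in _ + X]big1 ?addr0// => k _.
by rewrite z// leq_addr.
Qed.

(** The norm as a real number, since the generic norm takes its values in [R[i]]. *)
Definition rnorm x : R := Num.sqrt (fine (l2_sqnorm (lattice_weight omega) x)).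

Lemma normE x : `|x| = (rnorm x)%:C.
Proof. exact: l2_normE. Qed.

Lemma rnorm_ge0 x : 0 <= rnorm x.
Proof. exact: sqrtr_ge0. Qed.

Lemma sqr_rnorm x : ((rnorm x) ^+ 2)%:E = l2_sqnorm (lattice_weight omega) x.
Proof.
by rewrite sqr_sqrtr ?fine_ge0 ?l2_sqnorm_ge0// fineK ?l2_sqnorm_fin ?l2_funP.
Qed.

Lemma sum_level_sqnorm_le x D : \sum_(N < D) level_sqnorm x N <= rnorm x ^+ 2.
Proof. by rewrite -lee_fin sqr_rnorm l2_sqnorm_ge. Qed.

Lemma level_sqnorm_le x N : level_sqnorm x N <= rnorm x ^+ 2.
Proof.
apply: le_trans (sum_level_sqnorm_le x N.+1); rewrite big_ord_recr /= lerDr.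
by apply: sumr_ge0 => k _; exact: level_sqnorm_ge0.
Qed.

Lemma rnorm_le x (K : R) : 0 <= K ->
  (forall D, \sum_(N < D) level_sqnorm x N <= K ^+ 2) -> rnorm x <= K.
Proof.
move=> K0 xK; rewrite -(@ler_pXn2r _ 2)// ?nnegrE ?rnorm_ge0//.
by rewrite -lee_fin sqr_rnorm l2_sqnorm_le.
Qed.

Lemma rnormD x y : rnorm (x + y) <= rnorm x + rnorm y.
Proof. by rewrite -lecR rmorphD -!normE ler_normD. Qed.

Lemma rnormB x y : rnorm (x - y) = rnorm (y - x).
Proof. by apply: (@complexI R); rewrite -!normE distrC. Qed.

Lemma rnorm0 : rnorm 0 = 0.
Proof. by apply: (@complexI R); rewrite -normE normr0. Qed.

Lemma level_sqnorm_cvg0 x e : 0 < e -> exists N0, forall N, (N0 <= N)%N ->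
  level_sqnorm x N <= e.
Proof.
move=> e0; have [D De] :=
  tail_bounded_series (level_sqnorm_ge0 x) (sum_level_sqnorm_le x) e0.
exists D => N DN; apply: le_trans (De N.+1 (leqW DN)).
rewrite big_ord_recr /= addrAC lerDr subr_ge0.
rewrite -(subnKC DN) big_split_ord /= lerDl sumr_ge0// => k _.
exact: level_sqnorm_ge0.
Qed.

End lattice_l2.

(* The support is finite because [nth] defaults to zero. *)
Definition decode (R : realType) (c : seq (seq (rat * rat))) (v : nat * nat) : R[i] :=
  let p := nth (0, 0) (nth [::] c v.1) v.2 in ratr p.1 +i* ratr p.2.

Definition code_bound (c : seq (seq (rat * rat))) : nat :=
  (size c + \max_(s <- c) size s)%N.

Lemma decode_eq0 (R : realType) c v : (code_bound c <= v.1 + v.2)%N ->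
  decode R c v = 0.
Proof.
move=> cv; rewrite /decode.
suff -> : nth (0, 0) (nth [::] c v.1) v.2 = (0, 0) :> rat * rat by rewrite /= !rmorph0.
have [cs|vs] := leqP (size c) v.1; first by rewrite (nth_default [::] cs) nth_nil.
apply: nth_default; have : (size (nth [::] c v.1) <= \max_(s <- c) size s)%N.
  by apply: leq_bigmax_seq => //; exact: mem_nth.
by move: cv vs; rewrite /code_bound; lia.
Qed.

Lemma rat_approx (R : realType) (x e : R) : 0 < e -> exists r : rat, `|x - ratr r| <= e.
Proof.
move=> e0; have [|r] := @rat_in_itvoo R (x - e) (x + e); first lra.
by rewrite in_itv /= => /andP[h1 h2]; exists r; rewrite ler_norml; lra.
Qed.

Lemma complex_rat_approx (R : realType) (z : R[i]) (e : R) : 0 < e ->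
  exists p : rat * rat, normc (z - (ratr p.1 +i* ratr p.2)) <= e.
Proof.
move=> e0; have e2 : 0 < e / 2 by lra.
case: z => a b; have [r ar] := rat_approx a e2; have [s bs] := rat_approx b e2.
exists (r, s) => /=.
apply: (@le_trans _ _ (`|a - ratr r| + `|b - ratr s|)); last by lra.
rewrite -[leRHS]ger0_norm ?addr_ge0// -sqrtr_sqr ler_wsqrtr//.
rewrite [leRHS]sqrrD !real_normK ?num_real// addrAC lerDl.
by rewrite mulrn_wge0// mulr_ge0.
Qed.

(** * Density of rational finite vectors, and small preimages in the space *)

Section shift_on_l2.
Context {R : realType} (omega : nat -> R[i]).
Hypothesis omega_neq0 : forall n, omega n != 0.
Local Notation X := (l2 (lattice_weight_neq0 omega_neq0)).
Implicit Types x y : X.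

Lemma decode_in_l2 c : exists x : X, forall v, x v = decode R c v.
Proof. exact: l2_of_finite_levels (@decode_eq0 R c). Qed.

Lemma rnorm_code_approx x (e : R) : 0 < e ->
  exists c, forall y : X, (forall v, y v = decode R c v) -> rnorm (x - y) <= e.
Proof.
move=> e0; have e2 : 0 < e ^+ 2 / 2 by rewrite divr_gt0 ?exprn_gt0.
have [D De] := tail_bounded_series (level_sqnorm_ge0 omega x)
  (@sum_level_sqnorm_le _ _ omega_neq0 x) e2.
(* Half of [e ^+ 2] is left to the tail from level [D] on; the other half is shared among the
   vertices below, at most [D] on each of [D] levels. *)
pose d : R := e ^+ 2 / 2 / (D * D).+1%:R.
have d0 : 0 < d by rewrite divr_gt0.
have approx v : exists r : rat * rat,
    weight omega (v.1 + v.2) * normc (x v - (ratr r.1 +i* ratr r.2)) ^+ 2 <= d.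
  have w0 := weight_gt0 omega_neq0 (v.1 + v.2).
  have [r hr] := @complex_rat_approx R (x v) (Num.sqrt (d / weight omega (v.1 + v.2)))
    ltac:(by rewrite sqrtr_gt0 divr_gt0).
  exists r; rewrite mulrC -ler_pdivlMr// -[leRHS]sqr_sqrtr ?(ltW (divr_gt0 d0 w0))//.
  by rewrite lerXn2r ?nnegrE ?normc_ge0 ?sqrtr_ge0.
have [p pP] := choice approx.
pose c := mkseq (fun i => mkseq (fun j => if (i + j < D)%N then p (i, j) else (0, 0)) D) D.
exists c => y yE.
have cE v : decode R c v = if (v.1 + v.2 < D)%N then
    ratr (p v).1 +i* ratr (p v).2 else 0.
  rewrite /decode; case: v => i j /=.
  have [iD|Di] := ltnP i D; last first.
    rewrite (nth_default [::]) ?size_mkseq// nth_nil /= !rmorph0.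
    by rewrite ltnNge (leq_trans Di (leq_addr _ _)).
  rewrite nth_mkseq//; have [jD|Dj] := ltnP j D; last first.
    rewrite nth_default ?size_mkseq// /= !rmorph0.
    by rewrite ltnNge (leq_trans Dj (leq_addl _ _)).
  by rewrite nth_mkseq//; case: ifP => // _; rewrite /= !rmorph0.
apply: rnorm_le => [|n]; first exact: ltW.
have lo N : (N < D)%N -> level_sqnorm omega (x - y) N <= D%:R * d.
  move=> ND; rewrite /level_sqnorm /level_energy mulr_sumr.
  apply: (@le_trans _ _ (\sum_(k < N.+1) d)).
    apply: ler_sum => k _; have kN : (k <= N)%N by rewrite -ltnS.
    rewrite /level -[X in normc X]/(x (nat_of_ord k, (N - k)%N) - y (nat_of_ord k, (N - k)%N)).
    rewrite yE cE /= subnKC// ND.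
    by have := pP (nat_of_ord k, (N - k)%N); rewrite /= subnKC.
  by rewrite sumr_const card_ord -[leLHS]mulr_natl ler_wpM2r ?(ltW d0)// ler_nat.
have hi N : (D <= N)%N -> level_sqnorm omega (x - y) N = level_sqnorm omega x N.
  move=> DN; apply: eq_level_sqnorm => v vN.
  by rewrite -[LHS]/(x v - y v) yE cE vN ltnNge DN subr0.
have loD : \sum_(N < D) level_sqnorm omega (x - y) N <= e ^+ 2 / 2.
  apply: (@le_trans _ _ (\sum_(N < D) D%:R * d)); first by apply: ler_sum => N _; exact: lo.
  rewrite sumr_const card_ord -[leLHS]mulr_natl mulrA -natrM /d mulrCA.
  by rewrite ler_piMr ?(ltW e2)// ler_pdivrMr// mul1r ler_nat.
have [nD|Dn] := leqP n D.
  apply: (@le_trans _ _ (\sum_(N < D) level_sqnorm omega (x - y) N)); last by lra.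
  rewrite -(subnKC nD) big_split_ord /= lerDl sumr_ge0// => k _.
  exact: level_sqnorm_ge0.
have := De n (ltnW Dn).
rewrite -(subnKC (ltnW Dn)) !big_split_ord /= addrAC subrr add0r => h.
rewrite [X in _ + X](eq_bigr (fun i : 'I_(n - D) => level_sqnorm omega x (D + i))); last first.
  by move=> i _; rewrite hi// leq_addr.
lra.
Qed.

(* The square of the quantity in the theorem is [gain q n / weight q]. *)
Definition gain q n : R := weight omega (q + n) * rate q n.

Lemma gain_ge0 q n : 0 <= gain q n.
Proof. by rewrite mulr_ge0 ?weight_ge0// ltW ?rate_gt0. Qed.

(** Each of the finitely many levels of [f] has its own small preimage, and these sit on distinct
    levels. Vanishing below level [n] will make infinite sums of such vectors finite at every
    vertex. *)
Lemma backward_shift_preimage (f : nat * nat -> R[i]) D :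
  (forall v, (D <= v.1 + v.2)%N -> f v = 0) ->
  exists2 C : R, 0 <= C & forall n, exists x : X,
    [/\ forall v, iter n (@backward_shift R[i]) x v = f v,
        forall v, (v.1 + v.2 < n)%N -> x v = 0 &
        rnorm x ^+ 2 <= C * \sum_(q < D) gain q n].
Proof.
move=> f0.
have preim q : exists C : R, 0 <= C /\
    forall n, exists h : nat -> R[i],
    (forall i, (i <= q)%N -> iter n (@level_shift R[i]) h i = level q f i) /\
    level_energy (q + n) h <= C * rate q n.
  by have [C C0 H] := level_preimage q (level q f); exists C.
have [CC CCP] := choice preim.
exists (\sum_(q < D) CC q).
  by apply: sumr_ge0 => q _; have [] := CCP q.
move=> n.
have [h hP] := choice (fun q => (CCP q).2 n).
(* Level [n + q] carries [h q], the preimage of level [q] of [f]. *)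
pose g v : R[i] := if (n <= v.1 + v.2 < n + D)%N then h (v.1 + v.2 - n)%N v.1 else 0.
have glow N : (N < n)%N -> level_sqnorm omega g N = 0.
  move=> Nn; apply: level_sqnorm0 => v vN.
  by rewrite /g vN leqNgt Nn.
have ghigh N : (n + D <= N)%N -> level_sqnorm omega g N = 0.
  move=> Nn; apply: level_sqnorm0 => v vN.
  by rewrite /g vN [(N < _)%N]ltnNge Nn andbF.
have gmid q : (q < D)%N -> level_sqnorm omega g (n + q) <= CC q * gain q n.
  move=> qD; rewrite /level_sqnorm /gain mulrCA addnC ler_wpM2l ?weight_ge0//.
  apply: le_trans (proj2 (hP q)).
  rewrite le_eqVlt; apply/orP; left; apply/eqP; apply: eq_bigr => k _.
  have kq : (k <= q + n)%N by rewrite -ltnS.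
  have qnD : (q + n < n + D)%N by rewrite addnC ltn_add2l.
  by rewrite /level /g /= subnKC// leq_addl qnD addnK.
have gsum : \sum_(N < n + D) level_sqnorm omega g N <= (\sum_(q < D) CC q) * \sum_(q < D) gain q n.
  rewrite big_split_ord /= big1 ?add0r => [|k _]; last exact: glow.
  rewrite mulr_suml; apply: ler_sum => q _.
  apply: (le_trans (gmid _ (ltn_ord q))).
  rewrite ler_wpM2l ?(proj1 (CCP q))// (bigD1 q)//= lerDl sumr_ge0// => k _.
  exact: gain_ge0.
have gK m : \sum_(N < m) level_sqnorm omega g N <= (\sum_(q < D) CC q) * \sum_(q < D) gain q n.
  apply: le_trans gsum; have [mD|Dm] := leqP m (n + D).
    rewrite -(subnKC mD) big_split_ord /= lerDl sumr_ge0// => k _.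
    exact: level_sqnorm_ge0.
  rewrite -(subnKC (ltnW Dm)) big_split_ord /= [X in _ + X]big1 ?addr0// => k _.
  by rewrite ghigh// leq_addr.
have [x xE] := l2_of_level_bound omega_neq0 gK.
exists x; split.
- move=> [i j]; rewrite iter_backward_shift.
  have [ijD|Dij] := ltnP (i + j) D; last first.
    rewrite f0// (eq_iter_level_shift (g := fun=> 0)) => [|k /andP[_ kn]].
      by elim: n {h hP g glow ghigh gmid gsum gK x xE} i {Dij} => [//|n IHn] i /=; rewrite /level_shift !IHn addr0.
    have kN : (k <= i + j + n)%N by rewrite (leq_trans kn)// leq_add2r leq_addr.
    have ijnD : (n + D <= i + j + n)%N by rewrite [leqRHS]addnC leq_add2l.
    by rewrite /level xE /g /= subnKC// [(_ < n + D)%N]ltnNge ijnD andbF.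
  have := (hP (i + j)%N).1 i (leq_addr _ _); rewrite [X in _ = X]/level addKn => <-.
  apply: eq_iter_level_shift => k /andP[_ kn].
  have kN : (k <= i + j + n)%N by rewrite (leq_trans kn)// leq_add2r leq_addr.
  have ijnD : (i + j + n < n + D)%N by rewrite addnC ltn_add2l.
  by rewrite /level xE /g /= subnKC// leq_addl ijnD addnK.
- by move=> v vn; rewrite xE /g leqNgt vn.
- rewrite -lee_fin sqr_rnorm; apply: l2_sqnorm_le => m.
  rewrite (eq_bigr (fun N : 'I_m => level_sqnorm omega g N)) ?gK// => N _.
  by apply: eq_level_sqnorm => v _; rewrite xE.
Qed.

End shift_on_l2.

(** * Orbits *)

(** Radii of balls are elements of [R[i]], where positivity forces the imaginary part to be zero. *)
Lemma real_pos_complex (R : realType) (e : R[i]) : 0 < e ->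
  exists2 r : R, 0 < r & e = r%:C.
Proof.
case: e => a b; rewrite ltcE /= => /andP[/eqP -> a0]; by exists a.
Qed.

Section l2_topology.
Context {R : realType} (omega : nat -> R[i]).
Hypothesis omega_neq0 : forall n, omega n != 0.
Local Notation X := (l2 (lattice_weight_neq0 omega_neq0)).
Implicit Types x y : X.

Lemma open_rnorm_ball (U : set X) x : open U -> U x ->
  exists2 e : R, 0 < e & forall y, rnorm (x - y) < e -> U y.
Proof.
move=> oU Ux; have /nbhs_ballP[e /= /real_pos_complex[r r0 ->] eU] := open_nbhs_nbhs (conj oU Ux).
exists r => // y xy; apply: eU; rewrite -ball_normE /ball_ /= normE.
by rewrite ltcR.
Qed.

Lemma open_rnorm_ball_pair (U : set (X * X)) (p : X * X) : open U -> U p ->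
  exists2 e : R, 0 < e & forall y z, rnorm (p.1 - y) < e -> rnorm (p.2 - z) < e -> U (y, z).
Proof.
move=> oU Up; have /nbhs_ballP[e /= /real_pos_complex[r r0 ->] eU] := open_nbhs_nbhs (conj oU Up).
exists r => // y z py pz; apply: eU; split; rewrite -ball_normE /ball_ /= normE ltcR//.
Qed.

Lemma rnorm_ball_open x (e : R) : open [set y : X | rnorm (x - y) < e].
Proof.
rewrite (_ : [set _ | _] = ball x e%:C); first exact: ball_open.
by rewrite -ball_normE; apply/seteqP; split => y /=; rewrite /ball_ /= normE ltcR.
Qed.

End l2_topology.

(** * Necessity of small gains, and sufficiency for mixing *)

Section shift_operator.
Context {R : realType} (omega : nat -> R[i]).
Hypothesis omega_neq0 : forall n, omega n != 0.
Local Notation X := (l2 (lattice_weight_neq0 omega_neq0)).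
Implicit Types x y : X.
Variable B : {linear X -> X}.
Hypothesis BE : forall f v, B f v = backward_shift f v.

Lemma iter_BE n x v : iter n B x v = iter n (@backward_shift R[i]) x v.
Proof.
suff -> : iter n (@backward_shift R[i]) x = iter n B x by [].
elim: n => [//|n IHn]; rewrite !iterS IHn.
by apply/funext => w; rewrite BE.
Qed.

Lemma iter_B0 n : iter n B 0 = 0.
Proof. by elim: n => [//|n IHn]; rewrite iterS IHn raddf0. Qed.

Lemma iter_BD n x y : iter n B (x + y) = iter n B x + iter n B y.
Proof. by elim: n => [//|n IHn]; rewrite !iterS IHn raddfD. Qed.

Lemma iter_B_sum n m (f : nat -> X) :
  iter n B (\sum_(k < m) f k) = \sum_(k < m) iter n B (f k).
Proof.
elim: m => [|m IHm]; first by rewrite !big_ord0 iter_B0.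
by rewrite !big_ord_recr /= iter_BD IHm.
Qed.

Lemma iter_B_finite n x D : (forall v, (D <= v.1 + v.2)%N -> x v = 0) ->
  (D <= n)%N -> iter n B x = 0.
Proof.
move=> x0 Dn; apply/val_inj/funext => -[i j] /=.
rewrite iter_BE iter_backward_shift (eq_iter_level_shift (g := fun=> 0)) => [|k /andP[_ kn]].
  by elim: n i {Dn} => [//|n IHn] i /=; rewrite /level_shift !IHn addr0.
have kN : (k <= i + j + n)%N by rewrite (leq_trans kn)// leq_add2r leq_addr.
by rewrite /level x0//= subnKC// (leq_trans Dn)// leq_addl.
Qed.

Definition alt_form q y : R[i] :=
  pairing (@real_complex R) q ((1 - 'X) ^+ q) (level q y).

Lemma alt_formB q x y : alt_form q (x - y) = alt_form q x - alt_form q y.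
Proof. by rewrite /alt_form /pairing -sumrB; apply: eq_bigr => k _; rewrite -mulrBr. Qed.

Lemma alt_formZ q c x : alt_form q (c *: x) = c * alt_form q x.
Proof. by rewrite /alt_form /pairing mulr_sumr; apply: eq_bigr => k _; rewrite mulrCA. Qed.

Lemma alt_form_unit q : exists x : X, alt_form q x = 1.
Proof.
have v0 v : (q < v.1 + v.2)%N -> (v == (0, q)%N)%:R = 0 :> R[i].
  by case: (v =P (0, q)%N) => // ->; rewrite add0n ltnn.
have [x xE] := l2_of_finite_levels omega_neq0 v0.
exists x; rewrite /alt_form /pairing big_ord_recl big1 => [|k _].
  rewrite addr0 /level xE subn0 eqxx mulr1 -horner_coef0 horner_exp !hornerE.
  by rewrite subr0 expr1n.
by rewrite [level _ _ _]xE /= mulr0.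
Qed.

Lemma alt_form_cont q : exists2 d : R, 0 < d & forall x, rnorm x < d ->
  normc (alt_form q x) <= 1.
Proof.
set E : R := energy ((1 - 'X) ^+ q) q; have E0 : 0 <= E by exact: energy_ge0.
have w0 := weight_gt0 omega_neq0 q.
have E1 : 0 < E + 1 by lra.
exists (Num.sqrt (weight omega q / (E + 1))); first by rewrite sqrtr_gt0 divr_gt0.
move=> x xd; rewrite -(@ler_pXn2r _ 2)// ?nnegrE ?normc_ge0// expr1n.
rewrite -(ler_pM2l w0) mulr1.
apply: le_trans (ler_wpM2l (ltW w0) (normc_pairing_le _ _ _)) _.
rewrite mulrCA -/E -/(level_sqnorm omega x q).
apply: (@le_trans _ _ (E * (weight omega q / (E + 1)))).
  rewrite ler_wpM2l//; apply: le_trans (level_sqnorm_le _ _) _.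
  rewrite -[leRHS]sqr_sqrtr ?(ltW (divr_gt0 w0 E1))//.
  by rewrite lerXn2r ?nnegrE ?rnorm_ge0 ?sqrtr_ge0// ltW.
rewrite mulrCA ler_piMr ?(ltW w0)// ler_pdivrMr//; lra.
Qed.

(** After [n] steps [alt_form q] is a functional on level [q + n] whose squared norm is O(1 /
    [rate q n]); Cauchy-Schwarz then bounds its value by the level norm of the starting vector. *)
Lemma gain_le q : exists2 C : R, 0 < C & forall n x,
  gain omega q n * normc (alt_form q (iter n B x)) ^+ 2 <= C * level_sqnorm omega x (q + n).
Proof.
have [C C0 CE] := bin_energy_rate (R := R) q; exists C => // n x.
have -> : alt_form q (iter n B x) =
    pairing (@real_complex R) (q + n) ((1 + 'X) ^+ n * (1 - 'X) ^+ q) (level (q + n) x).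
  have sp : (size ((1 - 'X : {poly R}) ^+ q)%R <= q.+1)%N.
    by have := @size_1BXn1DXn R q 0; rewrite expr0 mulr1 addn0.
  rewrite -pairing_iter_level_shift//; apply: eq_bigr => k _; congr (_ * _).
  by rewrite /level iter_BE iter_backward_shift subnKC// -ltnS.
apply: le_trans (ler_wpM2l (gain_ge0 omega q n) (normc_pairing_le _ _ _)) _.
rewrite [(1 + 'X) ^+ n * _]mulrC -/(bin_energy q n).
rewrite /gain /level_sqnorm.
rewrite [leLHS](_ : _ = (bin_energy q n * rate q n) *
  (weight omega (q + n) * level_energy (q + n) (level (q + n) x))); last by ring.
by rewrite ler_wpM2r// mulr_ge0 ?weight_ge0 ?level_energy_ge0.
Qed.

Lemma hypercyclic_gain : hypercyclic B ->
  forall q e N, 0 < e -> exists2 n, (N <= n)%N & gain omega q n < e.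
Proof.
move=> [x xdense] q e N e0.
have [C C0 CP] := gain_le q; have [d d0 dP] := alt_form_cont q.
have eC : 0 < e / (2 * C) by rewrite divr_gt0// mulr_gt0.
have [N0 N0P] := level_sqnorm_cvg0 x eC.
have [u u1] := alt_form_unit q.
(* An orbit point within [d] of [t *: u] has an [alt_form q] of modulus at least [t - 1]. This
   exceeds every value before time [N + N0], so the time is late, and it is at least 1. *)
pose t : R := 2 + \sum_(n < N + N0) normc (alt_form q (iter n B x)).
have s0 : 0 <= \sum_(n < N + N0) normc (alt_form q (iter n B x)).
  by apply: sumr_ge0 => k _; exact: normc_ge0.
have ne0 : [set y : X | rnorm (t%:C *: u - y) < d] !=set0.
  by exists (t%:C *: u); rewrite /= subrr rnorm0.
have [z [/= h [n _ ne]]] := xdense _ ne0 (@rnorm_ball_open R omega omega_neq0 _ _).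
rewrite -ne in h.
have tn : t <= 1 + normc (alt_form q (iter n B x)).
  have := dP _ h; rewrite alt_formB alt_formZ u1 mulr1 => h1.
  rewrite -[t]ger0_norm -?normc_real; last by rewrite addr_ge0.
  rewrite -[t%:C](subrK (alt_form q (iter n B x))).
  by apply: le_trans (le_normcD _ _) _; rewrite lerD2r.
have nN : (N + N0 <= n)%N.
  rewrite leqNgt; apply/negP => nN; move: tn; rewrite /t (bigD1 (Ordinal nN))//=.
  have : 0 <= \sum_(i < N + N0 | i != Ordinal nN) normc (alt_form q (iter i B x)).
    by apply: sumr_ge0 => k _; exact: normc_ge0.
  lra.
exists n; first exact: leq_trans (leq_addr _ _) nN.
have := CP n x; set a := normc _ => h1.
have a1 : 1 <= a by move: tn; rewrite /t -/a; lra.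
apply: (@le_lt_trans _ _ (C * (e / (2 * C)))); last first.
  by rewrite [ltLHS](_ : _ = e / 2); [lra|field; lra].
apply: (@le_trans _ _ (gain omega q n * a ^+ 2)).
  by rewrite ler_peMr ?gain_ge0// exprn_ege1.
apply: (le_trans h1); rewrite ler_wpM2l ?(ltW C0)// N0P//.
by rewrite (leq_trans (leq_addl N N0))// (leq_trans nN)// leq_addl.
Qed.

Lemma mixing_gain : mixing B ->
  forall q e, 0 < e -> exists N, forall n, (N <= n)%N -> gain omega q n < e.
Proof.
move=> Bmix q e e0.
have [C C0 CP] := gain_le q; have [d d0 dP] := alt_form_cont q.
have eC : 0 < e / (2 * C) by rewrite divr_gt0// mulr_gt0.
have r0 : 0 < Num.sqrt (e / (2 * C)) by rewrite sqrtr_gt0.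
have [u u1] := alt_form_unit q.
(* Start near 0, where all level norms are small, and arrive near [2 *: u], where [alt_form q] has
   modulus at least 1. *)
have [||N NP] := Bmix _ _ (@rnorm_ball_open R omega omega_neq0 0 (Num.sqrt (e / (2 * C)))) _
  (@rnorm_ball_open R omega omega_neq0 (2%:C *: u) d).
- by exists 0; rewrite /= subrr rnorm0.
- by exists (2%:C *: u); rewrite /= subrr rnorm0.
exists N => n /NP[_ [[x /= xr <-] h]].
have := CP n x; set a := normc _ => h1.
have a1 : 1 <= a.
  have := dP _ h; rewrite alt_formB alt_formZ u1 mulr1 => h2.
  have : 2 <= normc (2%:C - alt_form q (iter n B x)) + a.
    rewrite -[leLHS]ger0_norm// -normc_real.
    by rewrite -{1}[2%:C](subrK (alt_form q (iter n B x))) le_normcD.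
  lra.
apply: (@le_lt_trans _ _ (C * (e / (2 * C)))); last first.
  by rewrite [ltLHS](_ : _ = e / 2); [lra|field; lra].
apply: (@le_trans _ _ (gain omega q n * a ^+ 2)).
  by rewrite ler_peMr ?gain_ge0// exprn_ege1.
apply: (le_trans h1); rewrite ler_wpM2l ?(ltW C0)//.
apply: le_trans (level_sqnorm_le _ _) _.
rewrite -[leRHS]sqr_sqrtr ?(ltW eC)// lerXn2r ?nnegrE ?rnorm_ge0 ?sqrtr_ge0//.
by move: xr; rewrite rnormB subr0 => /ltW.
Qed.

(** Take finitely supported [x] near [u] and [y] near [w], and a small preimage [z] of [y]: for
    large [n] the shift annihilates [x], so [x + z] stays near [u] and is sent to [y]. *)
Lemma gain_mixing :
  (forall q e, 0 < e -> exists N, forall n, (N <= n)%N -> gain omega q n < e) -> mixing B.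
Proof.
move=> small U W oU [u Uu] oW [w Ww].
have [e e0 eU] := open_rnorm_ball oU Uu; have [d d0 dW] := open_rnorm_ball oW Ww.
have e2 : 0 < e / 2 by lra.
have d2 : 0 < d / 2 by lra.
have [c cP] := rnorm_code_approx u e2; have [x xE] := decode_in_l2 omega_neq0 c.
have [c' c'P] := rnorm_code_approx w d2; have [y yE] := decode_in_l2 omega_neq0 c'.
have [C C0 H] := backward_shift_preimage omega_neq0 (@decode_eq0 R c').
have sum_small D r : 0 < r -> exists N, forall n, (N <= n)%N -> \sum_(q < D) gain omega q n < r.
  elim: D r => [|D IH] r r0; first by exists 0%N => n _; rewrite big_ord0.
  have r2 : 0 < r / 2 by lra.
  have [N1 h1] := IH _ r2; have [N2 h2] := small D _ r2.
  exists (maxn N1 N2) => n; rewrite geq_max => /andP[n1 n2]; rewrite big_ord_recr /=.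
  by have := h1 n n1; have := h2 n n2; lra.
have C1 : 0 < C + 1 by lra.
have [|N NP] := sum_small (code_bound c') ((e / 4) ^+ 2 / (C + 1)).
  by rewrite divr_gt0// exprn_gt0//; lra.
exists (maxn N (code_bound c)) => n; rewrite geq_max => /andP[Nn cn].
have [z [z1 _ z2]] := H n.
have Bz : iter n B z = y by apply/val_inj/funext => v /=; rewrite iter_BE z1 yE.
have ze : rnorm z <= e / 4.
  rewrite -(@ler_pXn2r _ 2)// ?nnegrE ?rnorm_ge0//; last lra.
  apply: (le_trans z2).
  apply: (@le_trans _ _ ((C + 1) * ((e / 4) ^+ 2 / (C + 1)))); last by rewrite mulrC divfK//; lra.
  apply: ler_pM => //; [|lra|exact: ltW (NP n Nn)].
  by apply: sumr_ge0 => q _; exact: gain_ge0.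
exists y; split; last by apply: dW; have := c'P y yE; lra.
exists (x + z); last first.
  rewrite iter_BD Bz (@iter_B_finite n x (code_bound c)) ?add0r// => v cv.
  by rewrite xE decode_eq0.
apply: eU; rewrite opprD addrA.
apply: le_lt_trans (rnormD _ _) _.
have zN : rnorm (- z) = rnorm z by rewrite -[- z]sub0r rnormB subr0.
have := cP x xE; rewrite zN; lra.
Qed.

End shift_operator.

Lemma iter_pair (T : Type) (f : T -> T) m x y :
  iter m (fun p : T * T => (f p.1, f p.2)) (x, y) = (iter m f x, iter m f y).
Proof. by elim: m => [//|m IHm]; rewrite !iterS IHm. Qed.

(** * Sufficiency for weak mixing *)

Section weak_mixing.
Context {R : realType} (omega : nat -> R[i]).
Hypothesis omega_neq0 : forall n, omega n != 0.
Local Notation X := (l2 (lattice_weight_neq0 omega_neq0)).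
Implicit Types x y : X.
Variable B : {linear X -> X}.
Hypothesis BE : forall f v, B f v = backward_shift f v.

(** A comparison in [R[i]] passes to real parts. A bound at least 1 has monotone powers. *)
Lemma bounded_operator_rnorm : bounded_operator B ->
  exists2 M : R, 1 <= M & forall x, rnorm (B x) <= M * rnorm x.
Proof.
move=> [M MB]; exists (Num.max 1 (complex.Re M)); first by rewrite le_max lexx.
move=> x; apply: (@le_trans _ _ (complex.Re M * rnorm x)); last first.
  by rewrite ler_wpM2r ?rnorm_ge0// le_max lexx orbT.
have := MB x; rewrite !normE lecE => /andP[_]; case: M {MB} => a b /=.
by rewrite mulr0 subr0.
Qed.

Variable M : R.
Hypothesis M1 : 1 <= M.
Hypothesis MB : forall x, rnorm (B x) <= M * rnorm x.

Let M0 : 0 < M. Proof. exact: lt_le_trans M1. Qed.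

Lemma rnorm_iter_B n x : rnorm (iter n B x) <= M ^+ n * rnorm x.
Proof.
elim: n => [|n IHn]; first by rewrite mul1r.
rewrite iterS exprS -mulrA; apply: (le_trans (MB _)).
by rewrite ler_wpM2l// ltW.
Qed.

(** Test the bound on the indicator of [(N.+1, 0)], whose image has value 1 at [(N, 0)]. *)
Lemma weight_succ N : weight omega N <= M ^+ 2 * weight omega N.+1.
Proof.
have v0 v : (N.+2 <= v.1 + v.2)%N -> (v == (N.+1, 0)%N)%:R = 0 :> R[i].
  by case: (v =P (N.+1, 0)%N) => // ->; rewrite addn0 ltnn.
have [x xE] := l2_of_finite_levels omega_neq0 v0.
have xn : rnorm x ^+ 2 <= weight omega N.+1.
  rewrite -lee_fin sqr_rnorm; apply: l2_sqnorm_le => D.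
  have lx k : level_sqnorm omega x k <= (k == N.+1)%:R * weight omega N.+1.
    have [->|kN] := eqVneq k N.+1.
      rewrite mul1r /level_sqnorm -[leRHS]mulr1 ler_wpM2l ?weight_ge0//.
      rewrite /level_energy big_ord_recr /= big1 ?add0r => [|j _].
        by rewrite /level xE subnn eqxx normc1 expr1n.
      by rewrite /level xE xpair_eqE (ltn_eqF (ltn_ord j)) normc0 expr0n.
    rewrite mul0r level_sqnorm0// => -[i j] /= ij; rewrite xE.
    by case: eqP => // -[ii jj]; move: kN; rewrite -ij ii jj addn0 eqxx.
  apply: le_trans (ler_sum _ (fun k _ => lx (nat_of_ord k))) _.
  rewrite -mulr_suml ler_piMl ?weight_ge0//.
  have [ND|DN] := ltnP N.+1 D.
    by rewrite (bigD1 (Ordinal ND))//= eqxx big1 ?addr0// => k /negbTE; rewrite -val_eqE /= => ->.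
  rewrite big1// => k _; case: eqP => // kN; move: (ltn_ord k); rewrite kN ltnNge.
  by rewrite DN.
have Bxn : weight omega N <= rnorm (B x) ^+ 2.
  apply: le_trans (level_sqnorm_le (B x) N).
  rewrite -[leLHS]mulr1 ler_wpM2l ?weight_ge0// /level_energy big_ord_recr /=.
  rewrite {2}/level BE subnn backward_shiftE !xE eqxx xpair_eqE /= andbF addr0 normc1 expr1n.
  by rewrite lerDr sumr_ge0// => k _; exact: sqr_ge0.
apply: (le_trans Bxn); apply: (@le_trans _ _ ((M * rnorm x) ^+ 2)).
  by rewrite lerXn2r ?nnegrE ?mulr_ge0 ?rnorm_ge0 ?(ltW M0).
by rewrite exprMn ler_wpM2l// sqr_ge0.
Qed.

Lemma weight_add N m : weight omega N <= (M ^+ 2) ^+ m * weight omega (N + m).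
Proof.
elim: m => [|m IHm]; first by rewrite mul1r addn0.
apply: (le_trans IHm); rewrite addnS [(M ^+ 2) ^+ m.+1]exprSr -mulrA ler_wpM2l ?weight_succ//.
by rewrite !exprn_ge0 ?(ltW M0).
Qed.

(* Boundedness gives [weight N <= M ^+ 2 * weight N.+1], so that a time which is
   good for level [D] is good for all lower levels. *)
Lemma gain_simultaneous :
  (forall q e N, 0 < e -> exists2 n, (N <= n)%N & gain omega q n < e) ->
  forall D e N, 0 < e -> exists2 n, (N <= n)%N & \sum_(q < D) gain omega q n < e.
Proof.
move=> small D e N e0; pose K : R := D.+1%:R * (M ^+ 2) ^+ D.
have M2 : 1 <= M ^+ 2 by rewrite exprn_ege1.
have K0 : 0 < K by rewrite mulr_gt0 ?ltr0n// exprn_gt0// exprn_gt0.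
have eK : 0 < e / K by rewrite divr_gt0.
have [n Nn nP] := small D _ N eK; exists n => //.
apply: (@le_lt_trans _ _ (K * gain omega D n)); last by rewrite mulrC -ltr_pdivlMr.
apply: (@le_trans _ _ (\sum_(q < D) (M ^+ 2) ^+ D * gain omega D n)).
  apply: ler_sum => q _; have qD := ltnW (ltn_ord q).
  apply: (@le_trans _ _ ((M ^+ 2) ^+ (D - q) * gain omega D n)); last first.
    by rewrite ler_wpM2r ?gain_ge0// ler_weXn2l// leq_subr.
  rewrite /gain mulrA; apply: ler_pM; rewrite ?weight_ge0 ?(ltW (rate_gt0 _ _)) ?rate_le//.
  by have := weight_add (q + n) (D - q); rewrite addnAC subnKC.
rewrite sumr_const card_ord -[leLHS]mulr_natl mulrA ler_wpM2r ?gain_ge0//.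
by rewrite ler_wpM2r ?ler_nat// !exprn_ge0 ?(ltW M0).
Qed.

(** The vector [x] is the sum of the [f k]. At time [n j] the earlier terms are annihilated, [f j]
    gives [y j], and the later terms are small enough to survive the growth [M ^+ n j]. By the last
    hypothesis the sum is finite at each vertex, so it is defined pointwise. *)
Lemma glue (n : nat -> nat) (f y : nat -> X) :
  (forall k, iter (n k) B (f k) = y k) ->
  (forall j k, (j < k)%N -> iter (n k) B (f j) = 0) ->
  (forall j k, (j < k)%N -> rnorm (f k) <= (2 ^+ k)^-1 * (M ^+ n j)^-1) ->
  (forall k v, (v.1 + v.2 < k)%N -> f k v = 0) ->
  exists x : X, forall k, rnorm (iter (n k) B x - y k) <= (2 ^+ k)^-1.
Proof.
move=> Bf Bf0 fle f0; pose s m : X := \sum_(k < m) f k.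
(* The difference in brackets is the sum of the [(2 ^+ k)^-1] for [j < k <= j + m]. *)
have sD j m : rnorm (s (j.+1 + m)%N - s j.+1) <=
    ((2 ^+ j)^-1 - (2 ^+ (j + m))^-1) * (M ^+ n j)^-1.
  elim: m => [|m IHm]; first by rewrite !addn0 !subrr mul0r rnorm0.
  rewrite addnS /s big_ord_recr /= -/(s _) addrAC.
  apply: le_trans (rnormD _ _) _.
  have := fle j (j.+1 + m)%N (leq_addr _ _) => h.
  apply: le_trans (lerD IHm h) _; rewrite -mulrDl ler_wpM2r ?invr_ge0 ?exprn_ge0 ?(ltW M0)//.
  rewrite addSn addnS le_eqVlt; apply/orP; left; apply/eqP.
  by rewrite [2 ^+ (j + m).+1]exprS; field; rewrite !expf_neq0.
have sle j m : (j < m)%N -> rnorm (s m - s j.+1) <= (2 ^+ j)^-1 * (M ^+ n j)^-1.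
  move=> jm; rewrite -(subnKC jm); apply: (le_trans (sD _ _)).
  rewrite ler_wpM2r ?invr_ge0 ?exprn_ge0 ?(ltW M0)// lerBlDr lerDl invr_ge0 exprn_ge0//.
have sv m m' v : (v.1 + v.2 < m)%N -> (m <= m')%N -> s m' v = s m v.
  move=> vm /subnKC <-; elim: (m' - m)%N => [|r IHr]; first by rewrite addn0.
  rewrite addnS /s big_ord_recr -/(s _) /= -[LHS]/(s (m + r)%N v + f (m + r)%N v).
  by rewrite IHr f0 ?addr0// (leq_trans vm)// leq_addr.
pose g v := s (v.1 + v.2).+1 v.
have gs D N : (N < D)%N -> level_sqnorm omega g N = level_sqnorm omega (s D) N.
  by move=> ND; apply: eq_level_sqnorm => v vN; rewrite /g -(sv _ D)// vN.
have gK D : \sum_(N < D) level_sqnorm omega g N <= (rnorm (s 1%N) + 1) ^+ 2.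
  rewrite (eq_bigr (fun N : 'I_D => level_sqnorm omega (s D) N)) => [|N _]; last exact: gs.
  apply: le_trans (sum_level_sqnorm_le _ _) _.
  rewrite lerXn2r ?nnegrE ?addr_ge0 ?rnorm_ge0//.
  case: D => [|D]; first by rewrite /s big_ord0 rnorm0 addr_ge0 ?rnorm_ge0.
  rewrite -[X in rnorm X](subrK (s 1%N)) addrC; apply: le_trans (rnormD _ _) _.
  rewrite lerD2l; apply: (le_trans (sle _ _ (ltn0Sn D))).
  by rewrite expr0 invr1 mul1r invf_le1 ?exprn_gt0// exprn_ege1.
have [x xE] := l2_of_level_bound omega_neq0 gK.
exists x => j.
have xs : rnorm (x - s j.+1) <= (2 ^+ j)^-1 * (M ^+ n j)^-1.
  apply: rnorm_le => [|D].
    by rewrite mulr_ge0 ?invr_ge0 ?exprn_ge0 ?(ltW M0).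
  (* Below level [D] the limit agrees with the partial sum of index [maxn D j.+1], which is also
     late enough for [sle]. *)
  have mj : (j < maxn D j.+1)%N by rewrite leq_max leqnn orbT.
  rewrite (eq_bigr (fun N : 'I_D => level_sqnorm omega (s (maxn D j.+1) - s j.+1) N)).
    apply: le_trans (sum_level_sqnorm_le _ _) _.
    by rewrite lerXn2r ?nnegrE ?rnorm_ge0 ?sle// (le_trans (rnorm_ge0 _) (sle _ _ mj)).
  move=> N _; apply: eq_level_sqnorm => v vN.
  rewrite -[LHS]/(x v - s j.+1 v) -[RHS]/(s _ v - s j.+1 v) xE /g -(sv _ (maxn D j.+1))//.
  by rewrite vN leq_max ltn_ord.
rewrite (_ : iter (n j) B x - y j = iter (n j) B (x - s j.+1)).
  apply: le_trans (rnorm_iter_B _ _) _.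
  by rewrite mulrC -ler_pdivlMr ?exprn_gt0.
have -> : y j = iter (n j) B (s j.+1).
  by rewrite /s iter_B_sum big_ord_recr /= Bf big1 ?add0r// => k _; rewrite Bf0.
by rewrite -{1}[x](subrK (s j.+1)) [X in X - _]iter_BD addrK.
Qed.

Lemma gain_weakly_mixing :
  (forall q e N, 0 < e -> exists2 n, (N <= n)%N & gain omega q n < e) -> weakly_mixing B.
Proof.
move=> small.
have [dec decE] := choice (fun c => decode_in_l2 omega_neq0 c).
have dec0 c v : (code_bound c <= v.1 + v.2)%N -> dec c v = 0.
  by move=> cv; rewrite decE decode_eq0.
(* [logn 2] takes every value infinitely often, so that every pair of codes is
   approximated with arbitrarily small error. *)
pose code := seq (seq (rat * rat)).
pose cd (k : nat) : code * code := odflt ([::], [::]) (unpickle (logn 2 k)).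
pose b k := maxn (code_bound (cd k).1) (code_bound (cd k).2).
(* Here [t] is a time with the two vectors added at stage [k], and [n0] is the previous time. The
   gap [b k.-1] lets the shift annihilate the previous targets; the summand [k] makes the new
   vectors vanish below level [k]. *)
pose good k (n0 : nat) (t : nat * (X * X)) :=
  [/\ (n0 + b k.-1 + k <= t.1)%N,
      iter t.1 B t.2.1 = dec (cd k).1, iter t.1 B t.2.2 = dec (cd k).2 &
      [/\ forall v, (v.1 + v.2 < k)%N -> t.2.1 v = 0,
          forall v, (v.1 + v.2 < k)%N -> t.2.2 v = 0,
          rnorm t.2.1 <= (2 ^+ k)^-1 * (M ^+ n0)^-1 &
          rnorm t.2.2 <= (2 ^+ k)^-1 * (M ^+ n0)^-1]].
have step (p : nat * nat) : exists t, good p.1 p.2 t.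
  case: p => k n0 /=.
  have [C1 C10 H1] := backward_shift_preimage omega_neq0 (@decode_eq0 R (cd k).1).
  have [C2 C20 H2] := backward_shift_preimage omega_neq0 (@decode_eq0 R (cd k).2).
  set e : R := (2 ^+ k)^-1 * (M ^+ n0)^-1.
  have e0 : 0 < e by rewrite mulr_gt0 ?invr_gt0 ?exprn_gt0.
  have C0 : 0 < C1 + C2 + 1 by lra.
  (* One time serves both components, as [C1] and [C2] are at most [C1 + C2]. *)
  have [|n nb ns] := @gain_simultaneous small (b k) (e ^+ 2 / (C1 + C2 + 1)) (n0 + b k.-1 + k).
    by rewrite divr_gt0// exprn_gt0.
  have bound c C (x : X) : (code_bound c <= b k)%N -> 0 <= C -> C <= C1 + C2 ->
      rnorm x ^+ 2 <= C * \sum_(q < code_bound c) gain omega q n -> rnorm x <= e.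
    move=> cb C00 CC xC; rewrite -(@ler_pXn2r _ 2)// ?nnegrE ?rnorm_ge0 ?(ltW e0)//.
    apply: (le_trans xC).
    apply: (@le_trans _ _ ((C1 + C2 + 1) * (e ^+ 2 / (C1 + C2 + 1)))); last by rewrite mulrC divfK//; lra.
    apply: ler_pM => //; [by apply: sumr_ge0 => q _; exact: gain_ge0|lra|].
    apply: le_trans (ltW ns); rewrite -(subnKC cb) [leRHS]big_split_ord /= lerDl sumr_ge0// => q _.
    exact: gain_ge0.
  have [x [x1 x2 x3]] := H1 n; have [y [y1 y2 y3]] := H2 n.
  have kn : (k <= n)%N by rewrite (leq_trans _ nb)// leq_addl.
  exists (n, (x, y)); split=> //=.
  - by apply/val_inj/funext => v /=; rewrite (iter_BE BE) x1 decE.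
  - by apply/val_inj/funext => v /=; rewrite (iter_BE BE) y1 decE.
  - split=> [v vk|v vk||].
    + by rewrite x2// (leq_trans vk).
    + by rewrite y2// (leq_trans vk).
    + apply: (bound _ _ _ _ _ _ x3) => //; [exact: leq_maxl|lra].
    + apply: (bound _ _ _ _ _ _ y3) => //; [exact: leq_maxr|lra].
have [F FP] := choice step.
pose s := fix s k : nat * (X * X) :=
  if k is k'.+1 then F (k'.+1, (s k').1) else F (0%N, 0%N).
pose n k := (s k).1.
have sg k : good k.+1 (n k) (s k.+1) by exact: (FP (k.+1, n k)).
have nS k : (n k + b k + k.+1 <= n k.+1)%N by have [] := sg k.
have nmono j m : (n j <= n (j + m))%N.
  by elim: m => [|m IHm]; [rewrite addn0|rewrite addnS (leq_trans IHm)// (leq_trans _ (nS _))// -addnA leq_addr].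
have nlt j k : (j < k)%N -> (n j + b j <= n k)%N.
  move=> jk; rewrite -(subnKC jk); apply: leq_trans (nmono j.+1 _).
  by apply: leq_trans (nS j); rewrite leq_addr.
have sgood k : exists2 n0, good k n0 (s k) & forall j, (j < k)%N -> (n j <= n0)%N.
  case: k => [|k]; first by exists 0%N => //; exact: (FP (0%N, 0%N)).
  by exists (n k) => // j; rewrite ltnS => jk; rewrite -(subnKC jk) nmono.
have Mle j m : (j <= m)%N -> (M ^+ m)^-1 <= (M ^+ j)^-1.
  by move=> jm; rewrite lef_pV2 ?posrE ?exprn_gt0// ler_weXn2l.
(* Between times [n j] and [n k] there are at least [b j] further shifts, which push the target
   [dec (c j)] out of its support. *)
have vanish (c : nat -> code) (f : nat -> X) : (forall k, code_bound (c k) <= b k)%N ->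
    (forall k, iter (n k) B (f k) = dec (c k)) ->
    forall j k, (j < k)%N -> iter (n k) B (f j) = 0.
  move=> cb fc j k /nlt jk; have njk : (n j <= n k)%N := leq_trans (leq_addr _ _) jk.
  rewrite -(subnK njk) iterD fc; apply: (iter_B_finite BE (dec0 (c j))).
  by rewrite (leq_trans (cb j))// leq_subRL.
have [x xP] : exists x : X, forall k, rnorm (iter (n k) B x - dec (cd k).1) <= (2 ^+ k)^-1.
  apply: (@glue n (fun k => (s k).2.1)).
  - by move=> k; have [n0 []] := sgood k.
  - apply: (vanish (fun k => (cd k).1)) => k; first exact: leq_maxl.
    by have [n0 []] := sgood k.
  - move=> j k jk; have [n0 [_ _ _ [_ _ h _]] /(_ _ jk) jn] := sgood k.
    by apply: (le_trans h); rewrite ler_wpM2l ?invr_ge0 ?exprn_ge0// Mle.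
  - by move=> k; have [n0 [_ _ _ []]] := sgood k.
have [y yP] : exists y : X, forall k, rnorm (iter (n k) B y - dec (cd k).2) <= (2 ^+ k)^-1.
  apply: (@glue n (fun k => (s k).2.2)).
  - by move=> k; have [n0 []] := sgood k.
  - apply: (vanish (fun k => (cd k).2)) => k; first exact: leq_maxr.
    by have [n0 []] := sgood k.
  - move=> j k jk; have [n0 [_ _ _ [_ _ _ h]] /(_ _ jk) jn] := sgood k.
    by apply: (le_trans h); rewrite ler_wpM2l ?invr_ge0 ?exprn_ge0// Mle.
  - by move=> k; have [n0 [_ _ _ []]] := sgood k.
exists (x, y) => U [p Up] oU.
have [e e0 eU] := open_rnorm_ball_pair oU Up.
have e2 : 0 < e / 2 by lra.
have [c1 c1P] := rnorm_code_approx p.1 e2; have [c2 c2P] := rnorm_code_approx p.2 e2.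
have [r r0] : exists r : nat, (2 ^+ r)^-1 < e / 2.
  exists (Num.bound (e / 2)^-1); rewrite invf_plt ?posrE ?exprn_gt0//.
  apply: lt_trans (archi_boundP _) _; first by rewrite invr_ge0 ltW.
  by rewrite -natrX ltr_nat ltn_expl.
(* The odd factor leaves the 2-adic valuation equal to the code and makes [k] at least [r]. *)
pose k := (2 ^ pickle (c1, c2) * r.*2.+1)%N.
have rk : (r <= k)%N.
  rewrite /k -[r in (r <= _)%N]mul1n leq_mul ?expn_gt0//.
  by rewrite -addnn -addnS leq_addr.
have cdk : cd k = (c1, c2).
  rewrite /cd /k lognM ?expn_gt0// pfactorK// lognE /= dvdn2 /= odd_double /= addn0.
  by rewrite pickleK.
have k2 : (2 ^+ k)^-1 < e / 2.
  by apply: le_lt_trans r0; rewrite lef_pV2 ?posrE ?exprn_gt0// ler_weXn2l// ler1n.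
exists (iter (n k) B x, iter (n k) B y); split; last by exists (n k); rewrite // iter_pair.
have fin c (z w : X) : rnorm (z - dec c) <= e / 2 -> rnorm (w - dec c) <= (2 ^+ k)^-1 ->
    rnorm (z - w) < e.
  move=> h1 h2; rewrite -[z](subrK (dec c)) -addrA.
  by apply: le_lt_trans (rnormD _ _) _; rewrite [X in _ + X < _]rnormB; lra.
apply: eU.
  by apply: (fin c1); [exact: c1P|have := xP k; rewrite cdk].
by apply: (fin c2); [exact: c2P|have := yP k; rewrite cdk].
Qed.

Lemma weakly_mixing_hypercyclic : weakly_mixing B -> hypercyclic B.
Proof.
move=> [[x y] xyd]; exists x => U [u Uu] oU.
have [||[p1 p2] [/= Up [m _]]] := xyd [set p | U p.1].
- by exists (u, u).
- by apply: open_comp => // p _; exact: cvg_fst.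
- by rewrite iter_pair => -[mp _]; exists p1; split=> //; exists m.
Qed.

End weak_mixing.

(** * Translation of the limit conditions and conclusion *)

Lemma limn_einf_eq0P (R : realType) (u : nat -> R) : (forall n, 0 <= u n) ->
  limn_einf (fun n => (u n)%:E) = 0%E <->
  (forall e N, 0 < e -> exists2 n, (N <= n)%N & u n < e).
Proof.
move=> u0; rewrite limn_einf_lim (cvg_lim _ (@cvg_einfs_sup _ (fun n => (u n)%:E)))//; split.
  move=> s0 e N e0; apply: contrapT => H.
  have : (einfs (fun n => (u n)%:E) N <= 0)%E.
    by rewrite -s0; apply: ereal_sup_ubound; exists N.
  apply/negP; rewrite -ltNge; apply: (@lt_le_trans _ _ e%:E); first by rewrite lte_fin.
  apply: le_ereal_inf_tmp => _ [n /= Nn <-]; rewrite lee_fin leNgt; apply/negP => ne.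
  by apply: H; exists n.
move=> H; apply/eqP; rewrite eq_le; apply/andP; split.
  apply: ge_ereal_sup => _ [N _ <-].
  apply/lee_addgt0Pr => e e0; rewrite add0e.
  have [n Nn ne] := H e N e0.
  by apply: (@le_trans _ _ (u n)%:E); [apply: ereal_inf_lbound; exists n|rewrite lee_fin ltW].
apply: (@le_trans _ _ (einfs (fun n => (u n)%:E) 0)); last by apply: ereal_sup_ubound; exists 0%N.
by apply: le_ereal_inf_tmp => _ [n _ <-]; rewrite lee_fin.
Qed.

Lemma cvg0_ge0P (R : realType) (u : nat -> R) : (forall n, 0 <= u n) ->
  (u n @[n --> \oo] --> 0) <->
  (forall e, 0 < e -> exists N, forall n, (N <= n)%N -> u n < e).
Proof.
move=> u0; split=> [/cvgrPdist_lt H e /H [N _ NP]|H].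
  exists N => n /NP; by rewrite /= sub0r normrN ger0_norm.
apply/cvgrPdist_lt => e /H[N NP]; exists N => // n /= /NP.
by rewrite sub0r normrN ger0_norm.
Qed.

(** Squaring doubles the exponent to [q + 1/2], that is, a natural power times a square root. *)
Lemma sqr_powR_rate (R : realType) q n :
  (n.+1%:R `^ (q%:R / 2%:R + 1 / 4%:R) / 2%:R ^+ n) ^+ 2 = rate q n :> R.
Proof.
rewrite expr_div_n -exprM mulnC exprM -natrX /rate; congr (_ / _).
rewrite expr2 -powRD ?pnatr_eq0 ?implybT//.
rewrite (_ : _ + _ + _ = q%:R + 2^-1); last by field.
by rewrite powRD ?pnatr_eq0 ?implybT// powR_mulrn// powR12_sqrt.
Qed.

Theorem corollary4p7 (R : realType) (omega : nat -> R[i])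
    (omega_neq0 : forall n, omega n != 0)
    (B : {linear l2 (lattice_weight_neq0 omega_neq0)
                 -> l2 (lattice_weight_neq0 omega_neq0)})
    (BE : forall f v, B f v = backward_shift f v)
    (Bbounded : bounded_operator B) :
  let a (q n : nat) : R :=
    normc (omega (q + n)%N) / normc (omega q)
    * (n.+1%:R `^ (q%:R / 2%:R + 1 / 4%:R) / 2%:R ^+ n) in
  [/\ hypercyclic B <-> weakly_mixing B,
      hypercyclic B <->
        (forall q : nat, limn_einf (fun n => (a q n)%:E) = 0%E)
    & mixing B <-> (forall q : nat, a q n @[n --> \oo] --> 0) ].
Proof.
move=> a.
have [M M1 MB] := bounded_operator_rnorm Bbounded.
have a0 q n : 0 <= a q n.
  by rewrite mulr_ge0 ?divr_ge0 ?normc_ge0 ?powR_ge0 ?exprn_ge0.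
have w0 := weight_gt0 omega_neq0.
have a2 q n : a q n ^+ 2 = gain omega q n / weight omega q.
  by rewrite /a exprMn sqr_powR_rate expr_div_n /gain mulrAC.
have a_small q n e : 0 < e -> (a q n < e) = (gain omega q n < e ^+ 2 * weight omega q).
  move=> e0; rewrite -(@ltr_pXn2r _ 2)// ?nnegrE ?(ltW e0)// a2.
  by rewrite ltr_pdivrMr.
have g_small q n e : 0 < e ->
    (gain omega q n < e) = (a q n < Num.sqrt (e / weight omega q)).
  move=> e0; rewrite a_small ?sqrtr_gt0 ?divr_gt0//.
  by rewrite sqr_sqrtr ?divfK ?gt_eqF// ltW// divr_gt0.
have s0 q e : 0 < e -> 0 < Num.sqrt (e / weight omega q).
  by move=> e0; rewrite sqrtr_gt0 divr_gt0.
have t0 q e : 0 < e -> 0 < e ^+ 2 * weight omega q.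
  by move=> e0; rewrite mulr_gt0// exprn_gt0.
have liminfP : (forall q, limn_einf (fun n => (a q n)%:E) = 0%E) <->
    (forall q e N, 0 < e -> exists2 n, (N <= n)%N & gain omega q n < e).
  split=> H q.
    move=> e N e0; have /limn_einf_eq0P := H q => /(_ (a0 q) _ N (s0 q e e0)) [n Nn ne].
    by exists n; rewrite // g_small.
  apply/limn_einf_eq0P => // e N e0; have [n Nn ne] := H q _ N (t0 q e e0).
  by exists n; rewrite // a_small.
have limP : (forall q, a q n @[n --> \oo] --> 0) <->
    (forall q e, 0 < e -> exists N, forall n, (N <= n)%N -> gain omega q n < e).
  split=> H q.
    move=> e e0; have /cvg0_ge0P := H q => /(_ (a0 q) _ (s0 q e e0)) [N NP].
    by exists N => n Nn; rewrite g_small// NP.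
  apply/cvg0_ge0P => // e e0; have [N NP] := H q _ (t0 q e e0).
  by exists N => n Nn; rewrite a_small// NP.
(* The cycle from hypercyclicity to frequently small gains, to weak mixing, and back yields both
   equivalences of the first part. *)
have hyp_weak : hypercyclic B -> weakly_mixing B.
  by move=> /(hypercyclic_gain BE)/(gain_weakly_mixing BE M1 MB).
split; first by split=> // /weakly_mixing_hypercyclic.
- split=> [/(hypercyclic_gain BE)/liminfP//|/liminfP H].
  exact/weakly_mixing_hypercyclic/(gain_weakly_mixing BE M1 MB).
- by split=> [/(mixing_gain BE)/limP//|/limP/(gain_mixing BE)].
Qed.
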